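(* Let $\alpha>-1$ and let $f:\mathbb{D}\to\mathbb{D}$ be an $\alpha$-harmonic function (i.e. $f=P_\alpha[f^\ast]$ for some $f^\ast\in L^\infty(\mathbb{T})$) with $f(0)=0$. Then for every $z\in\mathbb{D}$, with $r=|z|$, $$|f(z)|\le\frac{2(2+\alpha)\,r\,(1-r^2)^{1+\alpha}\,\Gamma\!\left(1+\frac{\alpha}{2}\right)^2}{\pi\,\Gamma(1+\alpha)\,(1+r^2)^{2+\frac{\alpha}{2}}}\;{}_3F_2\!\left(\begin{matrix}1,\ 1+\frac{\alpha}{4},\ \frac32+\frac{\alpha}{4}\\ \frac32,\ \frac32\end{matrix};\frac{4r^2}{(1+r^2)^2}\right).$$ For $\alpha=0$ the right-hand side equals $\frac{4}{\pi}\arctan r$.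
   Context: $\mathbb{D}$ is the open unit disk, $\mathbb{T}=\partial\mathbb{D}$. For $\alpha>-1$ let $c_\alpha=\frac{\Gamma(1+\alpha/2)^2}{\Gamma(1+\alpha)}$, $K_\alpha(z)=c_\alpha\frac{(1-|z|^2)^{\alpha+1}}{|1-z|^{\alpha+2}}$, and $P_\alpha[f^\ast](z)=\frac{1}{2\pi}\int_0^{2\pi}K_\alpha(ze^{-it})f^\ast(e^{it})\,dt$. ${}_3F_2$ denotes the generalized hypergeometric series ${}_3F_2\!\left(\begin{smallmatrix}a_1,a_2,a_3\\ b_1,b_2\end{smallmatrix};x\right)=\sum_{k\ge0}\frac{(a_1)_k(a_2)_k(a_3)_k}{(b_1)_k(b_2)_k\,k!}x^k$ with $(y)_k=\Gamma(y+k)/\Gamma(y)$. *)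

(* Defs.v *)
From HB Require Import structures.
From mathcomp Require Import all_boot all_order all_algebra.
From mathcomp Require Import all_classical all_reals all_analysis.
Set Implicit Arguments. Unset Strict Implicit. Unset Printing Implicit Defensive.
Import Order.TTheory GRing.Theory Num.Theory.
Import numFieldNormedType.Exports.
Local Open Scope classical_set_scope.
Local Open Scope ring_scope.

Section Defs.
Variable R : realType.

Definition Gamma (x : R) : R :=
  fine (\int[@lebesgue_measure R]_(t in `[0%R, +oo[) (t `^ (x - 1) * expR (- t))%:E).

Definition poch (y : R) (k : nat) : R := Gamma (y + k%:R) / Gamma y.

Definition hyp3F2 (a1 a2 a3 b1 b2 x : R) : R :=
  limn (series (fun k : nat => poch a1 k * poch a2 k * poch a3 k
                      / (poch b1 k * poch b2 k * k`!%:R) * x ^+ k)).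

Definition c_alpha (a : R) : R := Gamma (1 + a / 2) ^+ 2 / Gamma (1 + a).

(* Complex numbers are represented as pairs (Re, Im) of reals. *)
Definition cnorm (z : R * R) : R := Num.sqrt (z.1 ^+ 2 + z.2 ^+ 2).

(* K_alpha(z e^{-it}) = c_alpha (1-|z|^2)^(alpha+1) / |1 - z e^{-it}|^(alpha+2),
   using |1 - z e^{-it}| = |e^{it} - z|. *)
Definition Kalpha (a : R) (z : R * R) (t : R) : R :=
  c_alpha a * (1 - cnorm z ^+ 2) `^ (a + 1)
  / cnorm (cos t - z.1, sin t - z.2) `^ (a + 2).

(* P_alpha applied to a real-valued boundary function g(t) = g*(e^{it}) *)
Definition Palpha (a : R) (g : R -> R) (z : R * R) : R :=
  (2 * pi)^-1 * fine (\int[@lebesgue_measure R]_(t in `[0%R, 2 * pi]) (Kalpha a z t * g t)%:E).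

Definition bound_rhs (a r : R) : R :=
  (2 * (2 + a) * r * (1 - r ^+ 2) `^ (1 + a) * Gamma (1 + a / 2) ^+ 2)
  / (pi * Gamma (1 + a) * (1 + r ^+ 2) `^ (2 + a / 2))
  * hyp3F2 1 (1 + a / 4) (3 / 2 + a / 4) (3 / 2) (3 / 2)
           (4 * r ^+ 2 / (1 + r ^+ 2) ^+ 2).

End Defs.

(* Main.v *)
(* The kernel c (1-|z|^2)^(a+1) / |1-z e^{-it}|^(a+2) has boundary masses tending to 2 pi, so for
   a continuous phi the pairing of f* with phi is a limit of pairings of f(rho e^{is}) with phi;
   since |f| < 1 this bounds |int f* phi| by int |phi| without any almost everywhere radial limit.
   As f(0) = 0 means that f* has mean zero, one may take phi = K(z, .) - kappa for any constant
   kappa; the best one is the value of the kernel at the median angle, a right angle from arg z.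
   The resulting integral of |K(z, .) - kappa| is expanded by integrating the series of
   exp(sy) - exp(-sy) against s^(b-1) e^{-s} with b = 1 + a/2, which gives the 3F2. *)
Require Import Defs.
From HB Require Import structures.
From mathcomp Require Import all_boot all_order all_algebra.
From mathcomp Require Import all_classical all_reals all_analysis.
From mathcomp Require Import measurable_realfun ring lra.
Import Order.TTheory GRing.Theory Num.Theory.
Import numFieldNormedType.Exports.
Local Open Scope classical_set_scope.
Local Open Scope ring_scope.

(** For alpha different from 0 the kernel mass varies with the radius; that it tends to exactly 2 pi
    is Legendre duplication in disguise. As [Gamma] is a bare Lebesgue integral, its functional
    equation and the Beta and duplication identities are derived by Tonelli in the extended reals,
    where an identity comes before finiteness and often yields it. The pairing argument rests on the
    symmetry of the kernel in the two angles. In a double integral of phi(s) K(rho e^{is}, t) f*(t),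
    integrating over t first exhibits values of f, while integrating over s first exhibits phi
    averaged by the same kernel. The kernel decreases with the angular distance, so it crosses kappa
    at a right angle. Folding the circle onto a quarter cancels kappa and leaves an odd function of
    the cosine. The odd powers have Wallis integrals k!/(3/2)_k, which supply one of the two lower
    parameters 3/2; the other comes from (2k+1)!. Complex values are reduced to real ones by one
    fixed rotation, chosen to make f(z) a nonnegative real. *)

Section ChangeOfVariables.

(** * Affine substitutions and Tonelli on product sets *)

Context {R : realType}.
Local Notation mu := (@lebesgue_measure R).
Local Open Scope ereal_scope.

(** The pushforward of Lebesgue measure by the affine map, scaled by k, is a measure that gives
    half-open intervals their length, so uniqueness identifies it. *)
Lemma lebesgue_measure_affine (k c : R) (A : set R) : (0 < k)%R ->
  measurable A ->
  mu A = k%:E * mu ((fun x => k * x + c)%R @^-1` A).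
Proof.
move=> k0 mA.
pose phi : measurableTypeR R -> measurableTypeR R := (fun x : R => k * x + c)%R.
have mphi : measurable_fun setT phi by apply: measurable_funD => //; exact: measurable_funM.
have kge0 : (0 <= k)%R by exact: ltW.
pose m : {measure set _ -> \bar R} :=
  mscale (NngNum kge0) (measure_function_pushforward__canonical__measure_function_Measure mu mphi).
apply: (@lebesgue_measure_unique R m) => // _ [[a b]] _ <-.
rewrite /m/= /mscale/= /pushforward/=.
have -> : phi @^-1` `]a, b] = [set` `](a - c) / k, (b - c) / k]%R].
  apply/seteqP; split => x /=; rewrite !in_itv/= /phi ltr_pdivrMr// ler_pdivlMr// (mulrC k x).
    by move=> /andP[? ?]; apply/andP; split; lra.
  by move=> /andP[? ?]; apply/andP; split; lra.
rewrite !lebesgue_measure_itv/= !lte_fin.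
rewrite ltr_pM2r ?invr_gt0// ltrD2r; case: ifPn => ab; last by rewrite mule0.
rewrite -EFinM; congr EFin; field; exact: lt0r_neq0.
Qed.

Lemma ge0_integral_affine (k c : R) (D : set R) (f : R -> \bar R) : (0 < k)%R ->
  measurable D -> measurable_fun D f -> (forall x, D x -> 0 <= f x) ->
  \int[mu]_(x in D) f x =
  k%:E * \int[mu]_(x in (fun x => k * x + c)%R @^-1` D) f (k * x + c)%R.
Proof.
move=> k0 mD mf f0.
pose phi : measurableTypeR R -> measurableTypeR R := (fun x : R => k * x + c)%R.
have mphi : measurable_fun setT phi by apply: measurable_funD => //; exact: measurable_funM.
have kge0 : (0 <= k)%R by exact: ltW.
transitivity (k%:E * \int[measure_function_pushforward__canonical__measure_function_Measure mu mphi]_(x in D) f x); last first.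
  by rewrite (ge0_integral_pushforward mphi)// => x /set_mem; exact: f0.
rewrite -(@ge0_integral_mscale _ _ _
  (measure_function_pushforward__canonical__measure_function_Measure mu mphi) _ mD (NngNum kge0))//.
by apply: eq_measure_integral => A mA _; rewrite /= /mscale/= (@lebesgue_measure_affine k c).
Qed.

Lemma ge0_integral_scale0y (k : R) (f : R -> \bar R) : (0 < k)%R ->
  measurable_fun setT f -> (forall x, 0 <= f x) ->
  \int[mu]_(x in `[0%R, +oo[) f x = k%:E * \int[mu]_(x in `[0%R, +oo[) f (k * x)%R.
Proof.
move=> k0 mf f0; rewrite (@ge0_integral_affine k 0)//; last exact: measurable_funTS.
congr (_ * _); rewrite (_ : _ @^-1` _ = `[0%R, +oo[%classic).
  by apply: eq_integral => x _; rewrite addr0.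
by apply/seteqP; split => x /=; rewrite !in_itv/= !andbT addr0 pmulr_rge0.
Qed.

Lemma ge0_integral_shift (c : R) (D : set R) (f : R -> \bar R) :
  measurable D -> measurable_fun D f -> (forall x, D x -> 0 <= f x) ->
  \int[mu]_(x in D) f x = \int[mu]_(x in (fun x => x + c)%R @^-1` D) f (x + c)%R.
Proof.
move=> mD mf f0; rewrite (@ge0_integral_affine 1 c)// mul1e.
rewrite (_ : _ @^-1` D = (fun x => x + c)%R @^-1` D).
  by apply: eq_integral => x _; rewrite mul1r.
by apply/seteqP; split => x /=; rewrite mul1r.
Qed.

Lemma ge0_integral_reflect (c : R) (D : set R) (f : R -> \bar R) :
  measurable D -> measurable_fun D f -> (forall x, D x -> 0 <= f x) ->
  \int[mu]_(x in D) f x = \int[mu]_(x in (fun x => c - x)%R @^-1` D) f (c - x)%R.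
Proof.
move=> mD mf f0; rewrite (@ge0_integral_shift c)//.
set D' := _ @^-1` D; pose phi : measurableTypeR R -> measurableTypeR R := (-%R : R -> R).
have mphi : measurable_fun setT phi by exact: measurable_funN.
have mshift : measurable_fun setT ((fun x => x + c)%R : R -> R).
  exact: measurable_funD.
have mD' : measurable D' by rewrite -[D']setTI; exact: mshift.
rewrite (@eq_measure_integral _ _ _ _ (measure_function_pushforward__canonical__measure_function_Measure mu mphi)).
  rewrite (ge0_integral_pushforward mphi)//.
  - rewrite (_ : phi @^-1` D' = (fun x : R => (c - x)%R) @^-1` D).
      by apply: eq_integral => x _; rewrite /= /phi addrC.
    by apply/seteqP; split => x /=; rewrite /D'/= /phi addrC.
  - apply: (measurable_comp mD) => //; last exact: measurable_funTS.
    by move=> _ [x ? <-].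
  - by move=> x /set_mem ?; exact: f0.
by move=> A mA _; rewrite -[RHS]/(pushforward mu _ A) lebesgue_measureN.
Qed.

(** The indicators of both sets are absorbed into the integrand, which reduces the claim to Tonelli
    on the whole plane. *)
Lemma fubini_tonelli_in (A B : set R) (f : R * R -> R) :
  measurable A -> measurable B -> measurable_fun setT f ->
  (forall z, (0 <= f z)%R) ->
  \int[mu]_(x in A) \int[mu]_(y in B) (f (x, y))%:E =
  \int[mu]_(y in B) \int[mu]_(x in A) (f (x, y))%:E.
Proof.
move=> mA mB mf f0.
have ind (D : set R) (g : R -> R) : (fun x => (g x)%:E) \_ D = (fun x => (\1_D x * g x)%:E).
  by apply/funext => x; rewrite patchE indicE; case: ifP => _; rewrite ?mul1r ?mul0r.
have m1 (D : set R) : measurable D -> measurable_fun setT (\1_D : R -> R).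
  by move=> mD; exact: measurable_indic.
pose g (z : R * R) := (\1_A z.1 * (\1_B z.2 * f z))%:E.
have mg : measurable_fun setT g.
  apply/measurable_EFinP/measurable_funM.
    by apply: (@measurableT_comp _ _ _ _ _ _ (\1_A : R -> R)) => //; exact: m1.
  apply: measurable_funM => //.
  by apply: (@measurableT_comp _ _ _ _ _ _ (\1_B : R -> R)) => //; exact: m1.
have g0 z : 0 <= g z by rewrite lee_fin mulr_ge0// mulr_ge0.
have slice1 x : measurable_fun setT (fun y => f (x, y)) by exact: measurableT_comp.
have slice2 y : measurable_fun setT (fun x => f (x, y)) by exact: measurableT_comp.
transitivity (\int[mu]_x \int[mu]_y g (x, y)); last first.
  transitivity (\int[mu]_y \int[mu]_x g (x, y)); first exact: (@fubini_tonelli _ _ _ _ _ mu mu g).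
  rewrite [RHS]integral_mkcond; apply: eq_integral => y _.
  rewrite patchE; case: ifPn => yB.
    by rewrite [RHS]integral_mkcond; apply: eq_integral => x _; rewrite ind /g/=; congr EFin; rewrite [X in (_ * (X * _))%R]indicE yB mul1r.
  by rewrite integral0_eq// => x _; rewrite /g/= [X in (_ * (X * _))%R]indicE (negbTE yB) mul0r mulr0.
rewrite [LHS]integral_mkcond; apply: eq_integral => x _.
rewrite patchE; case: ifPn => xA.
  by rewrite integral_mkcond; apply: eq_integral => y _; rewrite ind /g/= [X in (X * (_ * _))%R]indicE xA mul1r.
by rewrite integral0_eq// => y _; rewrite /g/= [X in (X * (_ * _))%R]indicE (negbTE xA) mul0r.
Qed.

End ChangeOfVariables.

(** * Fundamental theorem of calculus from pointwise derivatives *)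

Section FTC.
Context {R : realType}.
Local Notation mu := (@lebesgue_measure R).

Lemma is_derive_continuous (f : R -> R) (x df : R) : is_derive x 1 f df -> {for x, continuous f}.
Proof. by move=> [fx _]; apply/differentiable_continuous/derivable1_diffP. Qed.

(* Not a class, so that [rewrite] leaves it as a side condition. *)
Definition has_derive (F : R -> R) (x d : R) : Prop := is_derive x 1 F d.

Lemma ge0_integral_derive_cy (f F : R -> R) (a l : R) :
  (forall x, a <= x -> 0 <= f x) -> (forall x, a <= x -> {for x, continuous f}) ->
  (forall x, a <= x -> has_derive F x (f x)) -> F x @[x --> +oo] --> l ->
  (\int[mu]_(x in `[a, +oo[) (f x)%:E = (l - F a)%:E)%E.
Proof.
move=> f0 cf dF Fl; rewrite EFinB; apply: ge0_continuous_FTC2y => //.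
- apply/continuous_within_itvcyP; split.
    by move=> x; rewrite in_itv/= andbT => /ltW; exact: cf.
  exact/cvg_at_right_filter/cf.
- by move=> x /ltW ax; apply: ex_derive; exact: (dF x).
- by apply/cvg_at_right_filter/is_derive_continuous/dF.
- by move=> x; rewrite in_itv/= andbT => /ltW ax; rewrite derive1E; apply: derive_val; exact: dF.
Qed.

Lemma integral_derive_cc (f F : R -> R) (a b : R) : a < b ->
  (forall x, a <= x <= b -> {for x, continuous f}) ->
  (forall x, a <= x <= b -> has_derive F x (f x)) ->
  (\int[mu]_(x in `[a, b]) (f x)%:E = (F b - F a)%:E)%E.
Proof.
move=> ab cf dF; rewrite EFinB.
have ha : a <= a <= b by rewrite lexx ltW.
have hb : a <= b <= b by rewrite lexx ltW.
apply: continuous_FTC2 => //.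
- apply/continuous_within_itvP => //; split.
  + by move=> x; rewrite in_itv/= => /andP[/ltW ? /ltW ?]; apply: cf; apply/andP.
  + exact/cvg_at_right_filter/cf.
  + exact/cvg_at_left_filter/cf.
- split.
  + by move=> x; rewrite in_itv/= => /andP[/ltW ? /ltW ?]; apply: ex_derive; apply: dF; apply/andP.
  + exact/cvg_at_right_filter/is_derive_continuous/dF.
  + exact/cvg_at_left_filter/is_derive_continuous/dF.
- move=> x; rewrite in_itv/= => /andP[/ltW ? /ltW ?].
  by rewrite derive1E; apply: derive_val; apply: dF; apply/andP.
Qed.

Lemma powR_continuous (p x : R) : 0 < x -> {for x, continuous (fun u : R => u `^ p)}.
Proof. by move=> x0; exact/is_derive_continuous/is_derive1_powR. Qed.

Lemma measurable_fun_powR d (T : measurableType d) (D : set T) (f : T -> R) p :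
  measurable_fun D f -> measurable_fun D (fun x => f x `^ p).
Proof. by move=> mf; exact: (@measurableT_comp _ _ _ _ _ _ (@powR R ^~ p)). Qed.

Lemma measurable_fun_expR d (T : measurableType d) (D : set T) (f : T -> R) :
  measurable_fun D f -> measurable_fun D (fun x => expR (f x)).
Proof. by move=> mf; exact: (@measurableT_comp _ _ _ _ _ _ (@expR R)). Qed.

End FTC.

Ltac meas := repeat first
  [ done | exact: measurable_cst | exact: measurable_fst | exact: measurable_snd
  | apply: measurable_fun_powR | apply: measurable_fun_expR | apply: measurable_funM
  | apply: measurable_funX
  | apply: measurable_funD | apply: measurable_funB | apply: measurable_funN ].

(** * The Gamma function and Pochhammer symbols *)

Section Gamma.
Context {R : realType}.
Local Notation mu := (@lebesgue_measure R).
Implicit Types x y l : R.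

(** Gamma before [fine]: an extended value lets identities be proved while convergence is still
    open. *)
Definition gammae x : \bar R :=
  (\int[mu]_(t in `[0%R, +oo[) (t `^ (x - 1) * expR (- t))%:E)%E.

Lemma GammaE x : Gamma x = fine (gammae x). Proof. by []. Qed.

Lemma gammae_ge0 x : (0 <= gammae x)%E.
Proof. by apply: integral_ge0 => t _; rewrite lee_fin mulr_ge0 ?powR_ge0 ?expR_ge0. Qed.

Lemma integral_powR_expR x l : 0 < l ->
  (\int[mu]_(t in `[0%R, +oo[) (t `^ (x - 1) * expR (- (l * t)))%:E =
   (l `^ (- x))%:E * gammae x)%E.
Proof.
move=> l0; rewrite /gammae [X in (_ * X)%E](@ge0_integral_scale0y _ l)//; last 2 first.
- by apply/measurable_EFinP; meas.
- by move=> t; rewrite lee_fin mulr_ge0 ?powR_ge0 ?expR_ge0.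
rewrite [X in (_ * (_ * X))%E](eq_integral (fun t : measurableTypeR R => ((l `^ (x - 1))%:E * (t `^ (x - 1) * expR (- (l * t)))%:E)%E)).
  rewrite ge0_integralZl//; last 3 first.
  - by apply/measurable_funTS/measurable_EFinP; meas.
  - by move=> t _; rewrite lee_fin mulr_ge0 ?powR_ge0 ?expR_ge0.
  - by rewrite lee_fin powR_ge0.
  rewrite !muleA -!EFinM.
  have -> : l `^ (- x) * l * l `^ (x - 1) = 1.
    rewrite powRB ?(gt_eqF l0) ?implybT// powRr1 ?ltW// powRN.
    by field; rewrite !gt_eqF ?powR_gt0.
  by rewrite mul1e.
move=> t; rewrite inE/= in_itv/= andbT => t0.
by rewrite -EFinM; congr EFin; rewrite (powRM _ (ltW l0) t0) -mulrA.
Qed.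

Lemma powRN_cvg0 y : 0 < y -> l `^ (- y) @[l --> +oo] --> (0 : R).
Proof.
move=> y0; apply/cvgr0Pnorm_lt => e e0.
near=> l; have : e `^ (- y^-1) < l by near: l; exact: nbhs_pinfty_gt.
have e1 : 0 < e `^ (- y^-1) by exact: powR_gt0.
move=> el; have l0 : 0 < l by exact: lt_trans el.
rewrite ger0_norm ?powR_ge0// powRN invf_plt ?posrE ?powR_gt0//.
rewrite [ltLHS](_ : _ = (e `^ (- y^-1)) `^ y).
  by apply: gt0_ltr_powR => //; rewrite nnegrE ltW.
by rewrite -powRrM mulNr mulVf ?gt_eqF// powR_inv1// ltW.
Unshelve. all: by end_near. Qed.

Lemma integral_1y_expR t : 0 < t ->
  (\int[mu]_(l in `[1%R, +oo[) (expR (- (l * t)))%:E = (expR (- t) / t)%:E)%E.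
Proof.
move=> t0.
rewrite (@ge0_integral_derive_cy _ _ (fun l => - (expR (- (l * t)) / t)) 1 0).
- by rewrite mul1r opprK add0r.
- by move=> x _; exact: expR_ge0.
- by move=> x _; apply: is_derive_continuous.
- move=> x _; rewrite /has_derive; apply: is_derive_eq.
  by rewrite /GRing.scale/=; field; exact: lt0r_neq0.
- rewrite -oppr0 -(mul0r t^-1); apply: cvgN; apply: cvgMl.
  apply: (cvg_comp (fun l => l * t) (fun u => expR (- u)) _ (@cvgr_expR R)).
  by apply: gt0_cvgMly => //; exact: cvg_id.
Qed.

Lemma integral_1y_powR y : 0 < y ->
  (\int[mu]_(l in `[1%R, +oo[) (l `^ (- (y + 1)))%:E = (y^-1)%:E)%E.
Proof.
move=> y0.
rewrite (@ge0_integral_derive_cy _ _ (fun l => - (l `^ (- y) / y)) 1 0).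
- by rewrite powR1 mul1r opprK add0r.
- by move=> x _; exact: powR_ge0.
- by move=> x x1; apply: powR_continuous; exact: lt_le_trans x1.
- move=> x x1; have x0 : 0 < x by exact: lt_le_trans x1.
  have d := is_derive1_powR (- y) x0.
  rewrite /has_derive; apply: is_derive_eq; rewrite /GRing.scale/= (_ : - y - 1 = - (y + 1)); last by ring.
  by field; exact: lt0r_neq0.
- by rewrite -oppr0 -(mul0r y^-1); apply: cvgN; apply: cvgMl; exact: powRN_cvg0.
Qed.

(* Integrating the Laplace transform of t^y over l >= 1 in both orders avoids an improper
   integration by parts, and holds before finiteness is known. *)
Lemma gammaeS y : 0 < y -> gammae (y + 1) = (y%:E * gammae y)%E.
Proof.
move=> y0.
pose f (z : R * R) := z.1 `^ y * expR (- (z.2 * z.1)).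
have mf : measurable_fun setT f by rewrite /f; meas.
have f0 z : 0 <= f z by rewrite mulr_ge0 ?powR_ge0 ?expR_ge0.
have mft l : measurable_fun setT (fun t => f (t, l)) by rewrite /f/=; meas.
have := @fubini_tonelli_in R `]0%R, +oo[%classic `[1%R, +oo[%classic f
  (measurable_itv _) (measurable_itv _) mf f0.
rewrite [X in X = _ -> _](_ : _ = gammae y); last first.
  rewrite /gammae -integral_itv_obnd_cbnd; last by apply/measurable_funTS/measurable_EFinP; meas.
  apply: eq_integral => t; rewrite inE/= in_itv/= andbT => t0.
  rewrite /f/=; under eq_integral do rewrite EFinM.
  rewrite ge0_integralZl//; last 2 first.
  - by apply/measurable_funTS/measurable_EFinP; meas.
  - by rewrite lee_fin powR_ge0.
  rewrite integral_1y_expR// -EFinM; congr EFin.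
  by rewrite powRB ?(gt_eqF t0) ?implybT// powRr1 ?ltW//; field; exact: lt0r_neq0.
rewrite [X in _ = X -> _](_ : _ = ((y^-1)%:E * gammae (y + 1))%E); last first.
  transitivity (\int[mu]_(l in `[1%R, +oo[) ((l `^ (- (y + 1)))%:E * gammae (y + 1)))%E.
    apply: eq_integral => l; rewrite inE/= in_itv/= andbT => l1.
    rewrite integral_itv_obnd_cbnd; last by apply/measurable_funTS/measurable_EFinP; exact: mft.
    have l0 : 0 < l by exact: lt_le_trans l1.
    rewrite -(integral_powR_expR _ _ l0).
    by apply: eq_integral => t _; rewrite addrK.
  rewrite ge0_integralZr//; last 3 first.
  - by apply/measurable_funTS/measurable_EFinP; meas.
  - by move=> l _; rewrite lee_fin powR_ge0.
  - exact: gammae_ge0.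
  by rewrite integral_1y_powR.
by move=> ->; rewrite muleA -EFinM divff ?gt_eqF// mul1e.
Qed.

Lemma gammae1 : gammae 1 = 1%:E.
Proof.
rewrite /gammae; under eq_integral do rewrite subrr powRr0 mul1r.
rewrite (@ge0_integral_derive_cy _ _ (fun t => - expR (- t)) 0 0).
- by rewrite oppr0 expR0 sub0r opprK.
- by move=> x _; exact: expR_ge0.
- by move=> x _; apply: is_derive_continuous.
- by move=> x _; rewrite /has_derive; apply: is_derive_eq; rewrite mulrN mulr1 opprK.
- by rewrite -oppr0; apply: cvgN; exact: cvgr_expR.
Qed.

Lemma gammae_nat n : gammae n.+1%:R = (n`!%:R)%:E.
Proof.
elim: n => [|n ih]; first by rewrite gammae1.
by rewrite -[n.+2%:R]natr1 gammaeS// ih -EFinM factS natrM.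
Qed.

(** For z >= 1 the factor t^(z-1) is at most 1 + t^n with n >= z - 1, so the integral is bounded by
    factorials. A smaller x > 0 is reached by reading the functional equation backwards from x +
    1. *)
Lemma gammae_lty x : 0 < x -> (gammae x < +oo)%E.
Proof.
suff h z : 1 <= z -> (gammae z < +oo)%E.
  move=> x0; have : (gammae (x + 1) < +oo)%E by apply: h; rewrite lerDr ltW.
  rewrite gammaeS//; have := gammae_ge0 x; case: (gammae x) => [r _ _|_|//]; first exact: ltry.
  by rewrite gt0_muley// lte_fin.
move=> z1; pose n := (Num.truncn z).
have zn : z - 1 <= n%:R.
  by have /andP[_ /ltW] := truncn_itv (le_trans ler01 z1); rewrite -natr1 lerBlDr.
apply: (@le_lt_trans _ _ (gammae 1 + gammae n.+1%:R)%E); last first.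
  by rewrite gammae1 gammae_nat -EFinD ltry.
have m w : measurable_fun (`[0%R, +oo[%classic : set (measurableTypeR R)) (fun t : measurableTypeR R => (t `^ (w - 1) * expR (- t))%:E).
  by apply/measurable_funTS/measurable_EFinP; meas.
have p w (t : R) : (0 <= (t `^ (w - 1) * expR (- t))%:E)%E.
  by rewrite lee_fin mulr_ge0 ?powR_ge0 ?expR_ge0.
rewrite /gammae -ge0_integralD//; apply: ge0_le_integral => //.
- exact: emeasurable_funD.
move=> t; rewrite /= in_itv/= andbT => t0.
rewrite -EFinD lee_fin -mulrDl ler_wpM2r ?expR_ge0// subrr powRr0.
have [t1|/ltW t1] := leP t 1.
  apply: (@le_trans _ _ 1); last by rewrite lerDl powR_ge0.
  have := @ge0_ler_powR R (z - 1) _ t 1; rewrite powR1; apply => //; first by rewrite subr_ge0.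
  by rewrite nnegrE.
apply: (@le_trans _ _ (t `^ (n.+1%:R - 1))); last by rewrite lerDr.
by apply: ler_powR => //; rewrite -natr1 addrK.
Qed.

Lemma gammae_gt0 x : 0 < x -> (0 < gammae x)%E.
Proof.
move=> x0.
(* On [1, 2] one has t^(x-1) >= 1/t >= 1/2 for every x > 0, and e^{-t} >= e^{-2}. *)
apply: (@lt_le_trans _ _ (\int[mu]_(t in `[1%R, 2%R]) (2^-1 * expR (- 2))%:E)%E).
  rewrite integral_cst//= lebesgue_measure_itv/= lte_fin ltr1n -EFinD -EFinM lte_fin.
  by rewrite mulr_gt0 ?mulr_gt0 ?expR_gt0//; lra.
apply: (@le_trans _ _ (\int[mu]_(t in `[1%R, 2%R]) (t `^ (x - 1) * expR (- t))%:E)%E).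
  apply: ge0_le_integral => //.
  - by apply/measurable_funTS/measurable_EFinP; meas.
  - move=> t; rewrite /= in_itv/= => /andP[t1 t2]; have t0 : 0 < t by exact: lt_le_trans t1.
    rewrite lee_fin ler_pM ?expR_ge0 ?ler_expR ?lerN2//.
    apply: (@le_trans _ _ (t `^ (-1))); first by rewrite powR_inv1 ?(ltW t0)// lef_pV2// posrE.
    by apply: ler_powR => //; rewrite lerBrDl addrN ltW.
apply: ge0_subset_integral => //.
- by apply/measurable_funTS/measurable_EFinP; meas.
- by move=> t _; rewrite lee_fin mulr_ge0 ?powR_ge0 ?expR_ge0.
- by move=> t; rewrite /= !in_itv/= andbT => /andP[t1 _]; exact: le_trans t1.
Qed.

Lemma gammaeE x : 0 < x -> gammae x = (Gamma x)%:E.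
Proof. by move=> x0; rewrite GammaE fineK// ge0_fin_numE ?gammae_ge0// gammae_lty. Qed.

Lemma Gamma_gt0 x : 0 < x -> 0 < Gamma x.
Proof. by move=> x0; rewrite -lte_fin -gammaeE// gammae_gt0. Qed.

Lemma GammaS y : 0 < y -> Gamma (y + 1) = y * Gamma y.
Proof.
move=> y0; apply: EFin_inj; rewrite EFinM -!gammaeE ?gammaeS//.
by rewrite addr_gt0.
Qed.

Lemma Gamma1 : Gamma (1 : R) = 1. Proof. by rewrite GammaE gammae1. Qed.

Lemma poch0 y : 0 < y -> poch y 0 = 1.
Proof. by move=> y0; rewrite /poch addr0 divff// gt_eqF// Gamma_gt0. Qed.

Lemma pochS y k : 0 < y -> poch y k.+1 = poch y k * (y + k%:R).
Proof.
move=> y0; rewrite /poch -natr1 addrA GammaS ?ltr_wpDr//.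
by rewrite -mulrA mulrC.
Qed.

Lemma poch_gt0 y k : 0 < y -> 0 < poch y k.
Proof. by move=> y0; rewrite divr_gt0 ?Gamma_gt0// ltr_wpDr. Qed.

Lemma poch1 k : poch (1 : R) k = k`!%:R.
Proof.
elim: k => [|k ih]; first by rewrite poch0.
by rewrite pochS// ih factS natrM mulrC nat1r.
Qed.

End Gamma.

(** * Rotating and folding integrals of functions of the cosine *)

Section Rotation.
Context {R : realType}.
Local Notation mu := (@lebesgue_measure R).
Implicit Types (a b c : R) (g : R -> \bar R).

Lemma ge0_integral_itvco_split a b c g : a <= b -> b <= c ->
  measurable_fun setT g -> (forall x, 0 <= g x)%E ->
  (\int[mu]_(x in `[a, c[) g x =
   \int[mu]_(x in `[a, b[) g x + \int[mu]_(x in `[b, c[) g x)%E.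
Proof.
move=> ab bc mg g0.
have -> : `[a, c[%classic = `[a, b[%classic `|` `[b, c[%classic.
  by rewrite -itv_bndbnd_setU// bnd_simp.
rewrite ge0_integral_setU//; first exact: measurable_funTS.
apply/disj_setPS => x [/=]; rewrite !in_itv/= => /andP[_ xb] /andP[bx _].
by move: (lt_le_trans xb bx); rewrite ltxx.
Qed.

Lemma ge0_integral_itvco_shift a b c g : measurable_fun setT g -> (forall x, 0 <= g x)%E ->
  (\int[mu]_(x in `[a, b[) g x = \int[mu]_(x in `[(a - c)%R, (b - c)%R[) g (x + c)%R)%E.
Proof.
move=> mg g0; rewrite (@ge0_integral_shift _ c)//; last exact: measurable_funTS.
congr (integral _ _ _); apply/seteqP; split => x /=; rewrite !in_itv/=.
  by move=> /andP[? ?]; apply/andP; split; lra.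
by move=> /andP[? ?]; apply/andP; split; lra.
Qed.

Lemma ge0_integral_itvco_cc a b g : measurable_fun setT g ->
  (\int[mu]_(x in `[a, b[) g x = \int[mu]_(x in `[a, b]) g x)%E.
Proof. by move=> mg; rewrite integral_itv_bndo_bndc//; exact: measurable_funTS. Qed.

Variable Phi : R -> R.
Hypothesis mPhi : measurable_fun setT Phi.
Hypothesis Phi0 : forall y, 0 <= Phi y.

Lemma measurable_fun_comp_cos [Psi : R -> R] : measurable_fun setT Psi ->
  measurable_fun setT (fun t : R => (Psi (cos t))%:E).
Proof.
move=> mPsi; apply/measurable_EFinP.
apply: (@measurableT_comp _ _ _ _ _ _ Psi) => //.
by apply: continuous_measurable_fun; exact: continuous_cos.
Qed.

(** Reflecting about pi/2 flips the sign of the cosine. With [Phi] the distance of the kernel from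
    kappa, the two summands are the sides where the kernel lies above and below kappa. *)
Lemma integral_0pi_cos :
  (\int[mu]_(t in `[0%R, pi]) (Phi (cos t))%:E =
   \int[mu]_(t in `[0%R, (pi / 2)%R]) (Phi (cos t))%:E +
   \int[mu]_(t in `[0%R, (pi / 2)%R]) (Phi (- cos t))%:E)%E.
Proof.
have mg := measurable_fun_comp_cos mPhi.
have g0 (t : R) : (0 <= (Phi (cos t))%:E)%E by rewrite lee_fin.
have pi0 := pi_gt0 R.
rewrite -ge0_integral_itvco_cc// (@ge0_integral_itvco_split _ (pi / 2))//; [|lra|lra].
rewrite ge0_integral_itvco_cc//; congr (_ + _)%E.
rewrite (@ge0_integral_reflect _ pi)//; last exact: measurable_funTS.
rewrite (_ : _ @^-1` _ = `]0%R, (pi / 2)%R]%classic); last first.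
  apply/seteqP; split => x /=; rewrite !in_itv/=.
    by move=> /andP[? ?]; apply/andP; split; lra.
  by move=> /andP[? ?]; apply/andP; split; lra.
have cosE (t : R) : cos (pi - t) = - cos t by rewrite addrC cosDpi cosN.
under eq_integral do rewrite cosE.
rewrite integral_itv_obnd_cbnd//.
apply: measurable_funTS; apply: (measurable_fun_comp_cos (Psi := fun y => Phi (- y))).
by apply: (@measurableT_comp _ _ _ _ _ _ Phi).
Qed.
End Rotation.

Section Rotation2.
Context {R : realType}.
Local Notation mu := (@lebesgue_measure R).

Lemma integral_circle_cos (Phi : R -> R) (s : R) : measurable_fun setT Phi ->
  (forall y, 0 <= Phi y) -> 0 <= s <= 2 * pi ->
  (\int[mu]_(t in `[0%R, (2 * pi)%R]) (Phi (cos (t - s)))%:E =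
   2%:E * \int[mu]_(t in `[0%R, pi]) (Phi (cos t))%:E)%E.
Proof.
move=> mPhi Phi0 /andP[s0 s2].
have mg := measurable_fun_comp_cos mPhi.
have g0 (t : R) : (0 <= (Phi (cos t))%:E)%E by rewrite lee_fin.
have mgs : measurable_fun setT (fun t : R => (Phi (cos (t - s)))%:E).
  apply: (@measurableT_comp _ _ _ _ _ _ (fun t : R => (Phi (cos t))%:E)) => //.
  exact: measurable_funB.
have gp (t : R) : cos (t + 2 * pi) = cos t by rewrite mulr_natl cosD2pi.
have pi0 := pi_gt0 R.
rewrite -ge0_integral_itvco_cc// (@ge0_integral_itvco_shift _ _ _ s)//=.
under eq_integral do rewrite addrK.
rewrite sub0r (@ge0_integral_itvco_split _ _ 0)//; [|lra|lra].
(* The arc that the rotation pushed below 0 is moved up by one period, so that the two arcs tile [0,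
   2 pi) again. *)
rewrite (@ge0_integral_itvco_shift _ (- s) 0 (- (2 * pi)))//.
rewrite [X in (X + _)%E](_ : _ = \int[mu]_(t in `[(2 * pi - s)%R, (2 * pi)%R[) (Phi (cos t))%:E)%E; last first.
  rewrite (_ : - s - - (2 * pi) = 2 * pi - s); last by ring.
  rewrite (_ : 0 - - (2 * pi) = 2 * pi); last by ring.
  by apply: eq_integral => t _; rewrite -[in RHS](subrK (2 * pi) t) gp.
rewrite addeC -ge0_integral_itvco_split//; [|lra|lra].
rewrite (@ge0_integral_itvco_split _ _ pi)//; [|lra|lra].
rewrite (@ge0_integral_itvco_shift _ pi (2 * pi) pi)// subrr (_ : 2 * pi - pi = pi); last by ring.
rewrite !ge0_integral_itvco_cc//; last first.
  by apply: (@measurableT_comp _ _ _ _ _ _ (fun t : R => (Phi (cos t))%:E)) => //; exact: measurable_funD.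
under [X in (_ + X)%E]eq_integral do rewrite cosDpi.
(* Shifted by pi, the second half of the circle carries [Phi (- cos t)]; folding at pi/2 merely
   exchanges the two summands, so it equals the first half. *)
have -> : (\int[mu]_(t in `[0%R, pi]) (Phi (- cos t))%:E = \int[mu]_(t in `[0%R, pi]) (Phi (cos t))%:E)%E.
  rewrite (@integral_0pi_cos _ Phi mPhi Phi0) (@integral_0pi_cos _ (fun y => Phi (- y)))//.
    by rewrite addeC; under [X in (X + _)%E]eq_integral do rewrite opprK.
  by apply: (@measurableT_comp _ _ _ _ _ _ Phi).
by rewrite -[in LHS](mul1e (integral _ _ _)) -ge0_muleDl// -EFinD.
Qed.

End Rotation2.

(** * Beta integrals and the duplication identity *)

Section BetaIntegrals.
Context {R : realType}.
Local Notation mu := (@lebesgue_measure R).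
Implicit Types (b u v : R).

Lemma measurable_fun_integral_in (B : set R) (f : R * R -> R) : measurable B ->
  measurable_fun setT f -> (forall z, 0 <= f z) ->
  measurable_fun setT (fun x : R => \int[mu]_(y in B) (f (x, y))%:E)%E.
Proof.
move=> mB mf f0.
pose g (z : R * R) := (\1_B z.2 * f z)%:E.
have mg : measurable_fun setT g.
  apply/measurable_EFinP/measurable_funM => //.
  by apply: (@measurableT_comp _ _ _ _ _ _ (\1_B : R -> R)).
have g0 z : (0 <= g z)%E by rewrite lee_fin mulr_ge0.
have := @measurable_fun_fubini_tonelli_F _ _ _ _ _ mu g mg g0.
congr (measurable_fun _ _); apply/funext => x; rewrite /fubini_F [RHS]integral_mkcond.
by apply: eq_integral => y _; rewrite patchE /g/= indicE; case: ifP => _; rewrite ?mul1r ?mul0r.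
Qed.

(** Half of B(1/2, b - 1/2). With b = 1 + a/2 the integrand is the profile of the kernel rescaled
    near a boundary point. *)
Definition cauchy_mass b : \bar R :=
  (\int[mu]_(u in `[0%R, +oo[) ((1 + u ^+ 2) `^ (- b))%:E)%E.

Lemma cauchy_mass_ge0 b : (0 <= cauchy_mass b)%E.
Proof. by apply: integral_ge0 => u _; rewrite lee_fin powR_ge0. Qed.

Lemma integral0y_gauss_scale (s : R) : 0 < s ->
  (\int[mu]_(u in `[0%R, +oo[) (expR (- (s * u ^+ 2)))%:E =
   (Num.sqrt pi / 2 * s `^ (- 2^-1))%:E)%E.
Proof.
move=> s0; have q0 : 0 < Num.sqrt s by rewrite sqrtr_gt0.
have := @integral0y_gauss R.
rewrite (@ge0_integral_scale0y _ (Num.sqrt s))//; last 2 first.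
- by apply/measurable_EFinP; exact: measurable_gauss_fun.
- by move=> x; rewrite lee_fin gauss_fun_ge0.
rewrite (eq_integral (fun u : measurableTypeR R => (expR (- (s * u ^+ 2)))%:E)); last first.
  by move=> u _; rewrite /gauss_fun exprMn sqr_sqrtr// ltW.
have p : (0 <= \int[mu]_(u in `[0%R, +oo[) (expR (- (s * u ^+ 2)))%:E)%E.
  by apply: integral_ge0 => u _; rewrite lee_fin expR_ge0.
set I := integral _ _ _ in p *.
case: I p => [r _|_|//]; last by rewrite gt0_muley ?lte_fin.
rewrite -EFinM => -[<-]; congr EFin.
rewrite powRN powR12_sqrt ?ltW// mulrAC divff ?mul1r// gt_eqF//.
Qed.

(** Gamma(b) (1 + u^2)^(-b) is the integral of s^(b-1) exp(-(1 + u^2) s) over s. Integrating over u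
    first leaves a Gaussian, hence the square root of pi and the loss of 1/2 in the exponent. *)
Lemma gammae_mul_cauchy_mass b : 2^-1 < b ->
  (gammae b * cauchy_mass b = (Num.sqrt pi / 2)%:E * gammae (b - 2^-1))%E.
Proof.
move=> b2.
pose f (z : R * R) := z.1 `^ (b - 1) * expR (- ((1 + z.2 ^+ 2) * z.1)).
have mf : measurable_fun setT f by rewrite /f; meas.
have f0 z : 0 <= f z by rewrite mulr_ge0 ?powR_ge0 ?expR_ge0.
have mft l : measurable_fun setT (fun t => f (t, l)) by rewrite /f/=; meas.
have := @fubini_tonelli_in R `]0%R, +oo[%classic `[0%R, +oo[%classic f
  (measurable_itv _) (measurable_itv _) mf f0.
rewrite [X in X = _ -> _](_ : _ = (Num.sqrt pi / 2)%:E * gammae (b - 2^-1))%E; last first.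
  have sp0 : 0 <= Num.sqrt pi / 2 :> R by rewrite divr_ge0// sqrtr_ge0.
  rewrite /gammae -ge0_integralZl//; last 2 first.
  - by apply/measurable_funTS/measurable_EFinP; meas.
  - by move=> s _; rewrite lee_fin mulr_ge0 ?powR_ge0 ?expR_ge0.
  rewrite -[RHS]integral_itv_obnd_cbnd; last first.
    by apply/measurable_funTS/emeasurable_funM; apply/measurable_EFinP; meas.
  apply: eq_integral => s; rewrite inE/= in_itv/= andbT => s0.
  transitivity (\int[mu]_(u in `[0%R, +oo[) ((s `^ (b - 1) * expR (- s))%:E * (expR (- (s * u ^+ 2)))%:E))%E.
    apply: eq_integral => u _; rewrite /f/= -EFinM; congr EFin.
    rewrite (_ : - ((1 + u ^+ 2) * s) = - s + - (s * u ^+ 2)); last by ring.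
    by rewrite expRD mulrA.
  rewrite ge0_integralZl//; last 2 first.
  - by apply/measurable_funTS/measurable_EFinP; meas.
  - by rewrite lee_fin mulr_ge0 ?powR_ge0 ?expR_ge0.
  rewrite integral0y_gauss_scale// -!EFinM; congr EFin.
  rewrite (_ : b - 2^-1 - 1 = (b - 1) + - 2^-1); last by ring.
  rewrite (powRD (r := b - 1)); last by rewrite (gt_eqF s0) implybT.
  by set x := s `^ _; set y := s `^ _; set e := expR _; set q := Num.sqrt _; ring.
move=> ->; rewrite muleC /cauchy_mass -ge0_integralZr//; last 3 first.
- by apply/measurable_funTS/measurable_EFinP; meas.
- by move=> s _; rewrite lee_fin powR_ge0.
- exact: gammae_ge0.
apply: eq_integral => u _.
rewrite integral_itv_obnd_cbnd; last by apply/measurable_funTS/measurable_EFinP; exact: mft.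
by rewrite /f/= integral_powR_expR// ltr_wpDr// sqr_ge0.
Qed.

(** Half of B(b, b): over (0, oo) the measure v^(b-1) (1 + v)^(-2b) dv is invariant under v ->
    1/v. *)
Definition beta_half b : \bar R :=
  (\int[mu]_(v in `[1%R, +oo[) (v `^ (b - 1) * (1 + v) `^ (- (2 * b)))%:E)%E.

Lemma beta_half_ge0 b : (0 <= beta_half b)%E.
Proof. by apply: integral_ge0 => u _; rewrite lee_fin mulr_ge0 ?powR_ge0. Qed.

(* By symmetry the double integral over s < t is half of Gamma(b)^2; substituting t = s v
   turns it into the Beta-type integral over v >= 1. *)
Lemma gammae_sqr b : 0 < b ->
  (gammae b * gammae b = 2%:E * (gammae (2 * b) * beta_half b))%E.
Proof.
move=> b0.
pose w (t : R) := t `^ (b - 1) * expR (- t).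
have w0 t : 0 <= w t by rewrite mulr_ge0 ?powR_ge0 ?expR_ge0.
have mw : measurable_fun setT w by rewrite /w; meas.
have mwE : measurable_fun setT (fun t => (w t)%:E) by exact/measurable_EFinP.
have gE : gammae b = (\int[mu]_(t in `]0%R, +oo[) (w t)%:E)%E.
  by rewrite /gammae -integral_itv_obnd_cbnd//; exact: measurable_funTS.
pose B := (\int[mu]_(s in `]0%R, +oo[) \int[mu]_(t in `[s, +oo[) (w s * w t)%:E)%E.
have BE : B = (gammae (2 * b) * beta_half b)%E.
  pose f (z : R * R) := z.1 `^ (2 * b - 1) * expR (- ((1 + z.2) * z.1)) * z.2 `^ (b - 1).
  have mf : measurable_fun setT f by rewrite /f; meas.
  have f0 z : 0 <= f z by rewrite !mulr_ge0 ?powR_ge0 ?expR_ge0.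
  transitivity (\int[mu]_(s in `]0%R, +oo[) \int[mu]_(v in `[1%R, +oo[) (f (s, v))%:E)%E.
    apply: eq_integral => s; rewrite inE/= in_itv/= andbT => s0.
    rewrite (@ge0_integral_affine _ s 0)//; last 2 first.
    - by apply/measurable_funTS/measurable_EFinP; exact: measurable_funM.
    - by move=> t _; rewrite lee_fin mulr_ge0.
    rewrite (_ : _ @^-1` _ = `[1%R, +oo[%classic); last first.
      by apply/seteqP; split => v /=; rewrite !in_itv/= !andbT addr0 -(ler_pM2l s0 1 v) mulr1.
    rewrite -ge0_integralZl//; last 3 first.
    - apply/measurable_funTS/measurable_EFinP/measurable_funM => //.
      by apply: (@measurableT_comp _ _ _ _ _ _ w) => //; meas.
    - by move=> t _; rewrite lee_fin mulr_ge0.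
    - by rewrite lee_fin ltW.
    apply: eq_integral => v; rewrite inE/= in_itv/= andbT => v1.
    rewrite -EFinM; congr EFin; rewrite /w /f/= addr0.
    rewrite (powRM _ (ltW s0)); last exact: le_trans v1.
    rewrite (_ : - ((1 + v) * s) = - s + - (s * v)); last by ring.
    rewrite (_ : 2 * b - 1 = 1 + ((b - 1) + (b - 1))); last by ring.
    have s1 : s != 0 by rewrite gt_eqF.
    rewrite (powRD (r := 1)) ?s1 ?implybT// (powRD (r := b - 1)) ?s1 ?implybT//.
    rewrite powRr1 ?ltW// expRD.
    by set x := s `^ _; set y := v `^ _; set e := expR _; set e' := expR _; ring.
  rewrite (@fubini_tonelli_in _ _ _ f)// muleC /beta_half -ge0_integralZr//; last 3 first.
  - by apply/measurable_funTS/measurable_EFinP; meas.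
  - by move=> v _; rewrite lee_fin mulr_ge0 ?powR_ge0.
  - exact: gammae_ge0.
  apply: eq_integral => v; rewrite inE/= in_itv/= andbT => v1.
  rewrite integral_itv_obnd_cbnd; last first.
    by apply/measurable_funTS/measurable_EFinP; rewrite /f/=; meas.
  under eq_integral do rewrite /f/= EFinM.
  rewrite ge0_integralZr//; last 3 first.
  - by apply/measurable_funTS/measurable_EFinP; meas.
  - by move=> s _; rewrite lee_fin mulr_ge0 ?powR_ge0 ?expR_ge0.
  - by rewrite lee_fin powR_ge0.
  rewrite integral_powR_expR; last by rewrite ltr_wpDr// (le_trans _ v1).
  by rewrite EFinM muleC muleA.
(* [h] takes the open part t < s and [k] below the closed part s <= t; the two partition the
   quadrant, with the diagonal in [k]. *)
pose h (z : R * R) := if z.2 < z.1 then w z.1 * w z.2 else 0.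
have mh : measurable_fun setT h.
  apply: measurable_fun_ifT => //; first exact: measurable_fun_ltr.
  by apply: measurable_funM; apply: (@measurableT_comp _ _ _ _ _ _ w).
have h0 z : 0 <= h z by rewrite /h; case: ifP => // _; rewrite mulr_ge0.
pose A := (\int[mu]_(s in `]0%R, +oo[) \int[mu]_(t in `]0%R, +oo[) (h (s, t))%:E)%E.
have AB : A = B.
  rewrite /A (@fubini_tonelli_in _ _ _ h (measurable_itv _) (measurable_itv _) mh h0).
  apply: eq_integral => t; rewrite inE/= in_itv/= andbT => t0.
  rewrite -integral_itv_obnd_cbnd; last first.
    by apply/measurable_funTS/measurable_EFinP; exact: measurable_funM.
  rewrite integral_mkcond [RHS]integral_mkcond; apply: eq_integral => s _.
  rewrite !patchE !mem_setE !in_itv/= !andbT /h/=.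
  case: (ltP t s) => ts; last by case: ifP.
  by rewrite (lt_trans t0 ts) mulrC.
pose k (z : R * R) := if z.1 <= z.2 then w z.1 * w z.2 else 0.
have mk : measurable_fun setT k.
  apply: measurable_fun_ifT => //; first exact: measurable_fun_ler.
  by apply: measurable_funM; apply: (@measurableT_comp _ _ _ _ _ _ w).
have k0 z : 0 <= k z by rewrite /k; case: ifP => // _; rewrite mulr_ge0.
have Bk : B = (\int[mu]_(s in `]0%R, +oo[) \int[mu]_(t in `]0%R, +oo[) (k (s, t))%:E)%E.
  apply: eq_integral => s; rewrite inE/= in_itv/= andbT => s0.
  rewrite integral_mkcond [RHS]integral_mkcond; apply: eq_integral => t _.
  rewrite !patchE !mem_setE !in_itv/= !andbT /k/=.
  case: (leP s t) => ts; last by case: ifP.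
  by rewrite (lt_le_trans s0 ts).
have AE : (gammae b * gammae b = A + B)%E.
  rewrite [X in (X * _)%E]gE -ge0_integralZr;
    [|exact: measurable_itv|exact: measurable_funTS|by move=> s _; rewrite lee_fin|exact: gammae_ge0].
  rewrite /A Bk -ge0_integralD; [|exact: measurable_itv| | | |]; last 4 first.
  - by move=> s _; apply: integral_ge0 => t _; rewrite lee_fin.
  - by apply: measurable_funTS; apply: measurable_fun_integral_in.
  - by move=> s _; apply: integral_ge0 => t _; rewrite lee_fin.
  - by apply: measurable_funTS; apply: measurable_fun_integral_in.
  apply: eq_integral => s; rewrite inE/= in_itv/= andbT => s0.
  rewrite -ge0_integralD; [|exact: measurable_itv| | | |]; last 4 first.
  - by move=> t _; rewrite lee_fin.
  - by apply/measurable_funTS/measurable_EFinP; exact: (@measurableT_comp _ _ _ _ _ _ h).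
  - by move=> t _; rewrite lee_fin.
  - by apply/measurable_funTS/measurable_EFinP; exact: (@measurableT_comp _ _ _ _ _ _ k).
  rewrite gE -ge0_integralZl;
    [|exact: measurable_itv|exact: measurable_funTS|by move=> t _; rewrite lee_fin|by rewrite lee_fin].
  apply: eq_integral => t _; rewrite -EFinM -EFinD; congr EFin.
  by rewrite /h /k/=; case: ltP => _; rewrite ?addr0 ?add0r.
by rewrite AE AB BE -mule2n -mule_natl.
Qed.

(** Substitute u = sinh(log v / 2) = (v^(1/2) - v^(-1/2)) / 2, an increasing map of [1, oo) onto [0,
    oo). It makes 1 + u^2 = (1 + v)^2 / (4 v), so both integrands become monomials in v and 1 +
    v. *)
Lemma cauchy_mass_beta_half b : 0 < b ->
  cauchy_mass (b + 2^-1) = ((4 `^ (b - 2^-1))%:E * beta_half b)%E.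
Proof.
move=> b0; pose h : R := 2^-1.
pose F v := (v `^ h - v `^ (- h)) / 2.
pose F' v := (v `^ (- h) + v `^ (- h - 1)) / 4.
pose G u := (1 + u ^+ 2) `^ (- (b + 2^-1)).
have dF v : 0 < v -> is_derive v 1 F (F' v).
  move=> v0; have d1 := is_derive1_powR h v0; have d2 := is_derive1_powR (- h) v0.
  apply: is_derive_eq; rewrite /GRing.scale/= /F' (_ : h - 1 = - h); last by rewrite /h; field.
  by rewrite !mulr0 add0r; set x := v `^ (- h); set y := v `^ (_ - _); rewrite /h; field.
have F'E v : 0 < v -> F^`()%classic v = F' v.
  by move=> v0; rewrite derive1E; apply: derive_val; exact: dF.
have cF' v : 0 < v -> {for v, continuous F'}.
  move=> v0; apply: (@continuousM _ _ (fun v => v `^ (- h) + v `^ (- h - 1))); last exact: cst_continuous.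
  by apply: (@continuousD _ _ _ (fun v => v `^ (- h))); exact: powR_continuous.
have near0 (v : R) : 0 < v -> \forall u \near v, F' u = F^`()%classic u.
  by move=> v0; near=> u; rewrite F'E//; near: u; exact: lt_nbhsr.
have cdF v : 0 < v -> {for v, continuous F^`()%classic}.
  move=> v0; rewrite /prop_for /continuous_at F'E//.
  apply: cvg_trans (cF' v v0); apply: near_eq_cvg; exact: near0.
have F1 : F 1 = 0 by rewrite /F !powR1 subrr mul0r.
rewrite /cauchy_mass -[X in `[X, +oo[%classic]F1.
rewrite (@increasing_ge0_integration_by_substitutiony _ F G 1).
- rewrite -ge0_integralZl//; last 2 first.
  + by apply/measurable_funTS/measurable_EFinP; meas.
  + by move=> v _; rewrite lee_fin mulr_ge0 ?powR_ge0.
  apply: eq_integral => v; rewrite inE/= in_itv/= andbT => v1.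
  have v0 : 0 < v by exact: lt_le_trans v1.
  rewrite -EFinM; congr EFin.
  rewrite [LHS]/(G (F v) * F^`()%classic v) F'E//.
  have e1 : v `^ h * v `^ (- h) = 1.
    by rewrite -powRD ?addrN ?powRr0// (gt_eqF v0) implybT.
  have e2 : v `^ h * v `^ h = v.
    rewrite -powRD ?(gt_eqF v0) ?implybT// (_ : h + h = 1) ?powRr1 ?ltW//.
    by rewrite /h; field.
  have e3 : v `^ (- h - 1) = v `^ (- h) / v.
    by rewrite powRB ?(gt_eqF v0) ?implybT// powRr1 ?ltW.
  have vn : v != 0 by rewrite gt_eqF.
  set s := v `^ h in e1 e2 *; set t := v `^ (- h) in e1 e3 *.
  have G1 : 1 + (F v) ^+ 2 = (1 + v) ^+ 2 / (4 * v).
    rewrite /F -/s -/t; apply: (mulIf (_ : v * 4 != 0)); first by rewrite mulf_neq0.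
    have -> : (1 + v) ^+ 2 / (4 * v) * (v * 4) = (1 + v) ^+ 2 by field.
    have -> : (1 + ((s - t) / 2) ^+ 2) * (v * 4) = v * (4 - 2 * (s * t)) + v * (s * s) + v * (t * t) by field.
    have e4 : v * (t * t) = 1.
      have -> : v * (t * t) = (s * t) * (s * t) by rewrite -[X in X * (t * t)]e2; ring.
      by rewrite e1 mulr1.
    by rewrite e1 e2 e4; ring.
  pose p := b + h; rewrite -/(p : R).
  rewrite [LHS](_ : _ = ((1 + v) ^+ 2 / (4 * v)) `^ (- p) * ((t + t / v) / 4)); last first.
    by rewrite /G G1 /F' -/t e3.
  have v10 : 0 < 1 + v by rewrite addr_gt0.
  have v4 : 0 < 4 * v by rewrite mulr_gt0.
  have -> : ((1 + v) ^+ 2 / (4 * v)) `^ (- p) =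
      (1 + v) `^ (- (2 * b)) / (1 + v) * (4 `^ (b - h) * 4 * (v `^ (b - 1) * (v * s))).
    rewrite powRM ?sqr_ge0 ?invr_ge0 ?(ltW v4)//; congr (_ * _).
      rewrite -(powR_mulrn 2 (ltW v10)) -powRrM (_ : 2%:R * - p = - (2 * b) - 1); last first.
        by rewrite /p /h; field.
      by rewrite powRB ?(gt_eqF v10) ?implybT// powRr1 ?(ltW v10).
    rewrite -(powR_inv1 (ltW v4)) -powRrM mulN1r opprK powRM ?(ltW v0)//; congr (_ * _).
      rewrite (_ : p = b - h + 1); last by rewrite /p /h; field.
      by rewrite powRD ?powRr1// pnatr_eq0 implybT.
    rewrite (_ : p = b - 1 + (1 + h)); last by rewrite /p; ring.
    by rewrite !powRD ?(gt_eqF v0) ?implybT// powRr1 ?(ltW v0).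
  have {G1}-> : (t + t / v) / 4 = t * (1 + v) / v / 4 by field.
  set X := _ `^ (- (2 * b)); set Y := 4 `^ _; set Z := v `^ (b - 1).
  have w0 : 1 + v != 0 by rewrite gt_eqF.
  rewrite (_ : X / (1 + v) * (Y * 4 * (Z * (v * s))) * (t * (1 + v) / v / 4) = Y * (Z * X) * (s * t)).
    by rewrite e1 mulr1.
  by clearbody s t X Y Z; field; rewrite vn w0.
- move=> x y; rewrite !in_itv/= !andbT => x1 y1 xy.
  have x0 : 0 < x by exact: lt_le_trans x1.
  have h0 : 0 < h by rewrite invr_gt0.
  rewrite /F ltr_pM2r ?invr_gt0// ltrB//.
    by apply: gt0_ltr_powR; rewrite ?nnegrE ?(ltW x0)// ltW// (lt_trans x0).
  rewrite !powRN ltf_pV2 ?posrE ?powR_gt0//; last exact: lt_trans xy.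
  by apply: gt0_ltr_powR; rewrite ?nnegrE ?(ltW x0)// ltW// (lt_trans x0).
- by move=> x; rewrite in_itv/= andbT => /(lt_trans ltr01) /cdF.
- apply/cvg_ex; exists (F^`()%classic 1).
  by apply: cvg_at_right_filter; exact: cdF.
- apply/cvg_ex; exists 0.
  have c : F' x @[x --> +oo] --> 0.
    rewrite -(mul0r 4^-1) -[X in X * _](addr0 0); apply: cvgMl; apply: cvgD.
      by apply: powRN_cvg0; rewrite invr_gt0.
    under eq_fun do rewrite -opprD.
    by apply: powRN_cvg0; rewrite addr_gt0 ?invr_gt0.
  apply: cvg_trans c; apply: near_eq_cvg.
  by apply: filterS (nbhs_pinfty_gt (num_real 0)) => x x0; rewrite F'E.
- split.
    by move=> x; rewrite in_itv/= andbT => /(lt_trans ltr01) /dF d; apply: ex_derive.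
  by apply: cvg_at_right_filter; apply: is_derive_continuous; exact: dF.
- apply/cvgryPge => A; near=> x.
  have x1 : 1 <= x by near: x; exact: nbhs_pinfty_ge.
  (* Chosen so that x^(1/2) >= 2|A| + 1; as x^(-1/2) <= 1, half the difference is at least |A|. *)
  have xA : (2 * `|A| + 1) ^+ 2 <= x by near: x; exact: nbhs_pinfty_ge.
  have x0 : 0 < x by exact: lt_le_trans x1.
  have l1 : 2 * `|A| + 1 <= x `^ h.
    have l0 : 0 <= 2 * `|A| + 1 by rewrite addr_ge0 ?mulr_ge0.
    rewrite /h powR12_sqrt ?(ltW x0)// -ler_sqr ?nnegrE ?sqrtr_ge0//.
    by rewrite sqr_sqrtr// ltW.
  have l2 : x `^ (- h) <= 1.
    by rewrite -(powRr0 x); apply: ler_powR => //; rewrite oppr_le0 invr_ge0.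
  have := ler_norm A; rewrite /F; lra.
- apply/continuous_within_itvcyP.
  have cG (u : R) : {for u, continuous G}.
    apply: (@continuous_comp _ _ _ (fun u : R => 1 + u ^+ 2) (fun v => v `^ (- (b + 2^-1)))).
      exact: is_derive_continuous.
    by apply: powR_continuous; rewrite ltr_wpDr// sqr_ge0.
  by split; [move=> u _; exact: cG|apply: cvg_at_right_filter; exact: cG].
- by move=> u _; exact: powR_ge0.
Unshelve. all: by end_near. Qed.

(** Legendre duplication in the form needed for the normalising constant. With c = b - 1/2 and J the
    value of [cauchy_mass b], it results from eliminating Gamma(c) and B = [beta_half c] from
    Gamma(b) J = sqrt(pi)/2 Gamma(c), Gamma(c)^2 = 2 Gamma(2c) B and J = 4^(c-1/2) B. *)
Lemma Gamma_sqr_cauchy_mass b : 2^-1 < b ->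
  (((Gamma b) ^+ 2 * 2 `^ (2 * b - 1) / pi)%:E * cauchy_mass b = (Gamma (2 * b - 1))%:E)%E.
Proof.
move=> b2; pose c := b - 2^-1.
have c0 : 0 < c by rewrite subr_gt0.
have bc : b = c + 2^-1 by rewrite subrK.
have b0 : 0 < b by lra.
have c20 : 0 < 2 * c by rewrite mulr_gt0.
have pi0 := pi_gt0 R.
have h1 := gammae_mul_cauchy_mass _ b2.
have h2 := gammae_sqr _ c0; have h3 := cauchy_mass_beta_half _ c0.
rewrite -bc -/c in h1 h3.
rewrite (_ : 2 * b - 1 = 2 * c); last by rewrite /c; field.
have := cauchy_mass_ge0 b; have := beta_half_ge0 c.
have Gb := Gamma_gt0 _ b0; have Gc := Gamma_gt0 _ c0; have G2c := Gamma_gt0 _ c20.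
rewrite !gammaeE// in h1 h2.
(* Finiteness is read off the identities: an infinite value would contradict a product of finite
   Gamma values. *)
case: (beta_half c) h2 h3 => [B h2 h3|h2 _|//]; last first.
  by move: h2; rewrite -EFinM !gt0_muley ?lte_fin.
case: (cauchy_mass b) h1 h3 => [J h1 h3|h1 _|//]; last first.
  by move: h1; rewrite -EFinM gt0_muley ?lte_fin.
move: h1 h2 h3; rewrite -!EFinM => -[h1] -[h2] -[h3] _ _; congr EFin.
have p4 : 4 `^ (c - 2^-1) = 2 `^ (2 * c) / 2 :> R.
  rewrite (_ : 4 = 2 `^ 2); last by rewrite (@powR_mulrn _ 2 2)// expr2 -natrM.
  rewrite -powRrM (_ : 2 * (c - 2^-1) = 2 * c - 1); last by field.
  by rewrite powRB ?powRr1// pnatr_eq0 implybT.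
have sp : Num.sqrt pi ^+ 2 = pi :> R by rewrite sqr_sqrtr// ltW.
rewrite p4 in h3; set T := 2 `^ _ in h3 *.
have G2 : Gamma b ^+ 2 * J ^+ 2 = pi / 4 * (2 * (Gamma (2 * c) * B)).
  by rewrite -exprMn h1 -h2 -[X in X / 4]sp; field.
have B0 : J != 0.
  apply/eqP => J0; move: h1; rewrite J0 mulr0 => /esym/eqP; rewrite gt_eqF//.
  by rewrite mulr_gt0 ?divr_gt0 ?sqrtr_gt0.
(* The elimination produces Gamma(b)^2 J^2, so the goal is multiplied by J and J is cancelled at the
   end. *)
apply: (mulIf B0).
rewrite (_ : _ * J * J = T / pi * (Gamma b ^+ 2 * J ^+ 2)); last by ring.
rewrite G2 h3; move: pi0; move: (pi : R) => p p0.
by field; rewrite gt_eqF.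
Qed.

End BetaIntegrals.

(** * Odd power series of exponentials and of binomial powers *)

Section Series.
Context {R : realType}.
Local Notation mu := (@lebesgue_measure R).
Implicit Types (x y b : R).

Lemma nneseries_EFin_cvg (u : R^nat) (l : R) :
  series u @ \oo --> l -> (\sum_(k <oo) (u k)%:E)%E = l%:E.
Proof.
move=> ul; apply/cvg_lim => //.
rewrite (_ : (fun n => _) = EFin \o series u); last first.
  by apply/funext => n; rewrite /= sumEFin.
by apply/fine_cvgP; split; [exact: nearW|exact: ul].
Qed.

(** [hyp3F2] is a [limn], meaningful only under convergence. The extended sum of nonnegative terms
    always exists, and its finiteness gives that convergence. *)
Lemma cvg_series_nneseries (u : R^nat) (l : R) : (forall k, 0 <= u k) ->
  (\sum_(k <oo) (u k)%:E)%E = l%:E -> series u @ \oo --> l.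
Proof.
move=> u0 ul.
have : (\sum_(0 <= k < n) (u k)%:E)%E @[n --> \oo] --> l%:E.
  by rewrite -ul; apply: is_cvg_nneseries => n _ _; rewrite lee_fin.
rewrite (_ : (fun n => _) = EFin \o series u); first by move/fine_cvgP => [].
by apply/funext => n; rewrite /= sumEFin.
Qed.

(** The difference of the two exponential series is grouped in consecutive pairs: even terms cancel
    and odd terms double. *)
Lemma expR_sub_expRN_series x :
  series (fun k => 2 * x ^+ (k.*2.+1) / (k.*2.+1)`!%:R) @ \oo --> expR x - expR (- x).
Proof.
have ce z : series (exp_coeff z) @ \oo --> expR z.
  by rewrite /expR; exact: is_cvg_series_exp_coeff.
pose f (n : nat) : R := x ^+ n / n`!%:R - (- x) ^+ n / n`!%:R.
have sf : series f = series (exp_coeff x) - series (exp_coeff (- x)).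
  by apply/funext => n; rewrite /series/= sumrB.
have cf : series f @ \oo --> expR x - expR (- x) by rewrite sf; apply: cvgB; exact: ce.
have cvf : cvg (series f @ \oo) by apply/cvg_ex; eexists; exact: cf.
have := @cvg_series_cvg_series_group _ f 2 cvf isT.
rewrite (cvg_lim _ cf)//; apply: cvg_trans.
rewrite [X in _ --> series X @ \oo](_ : _ = (fun k => 2 * x ^+ (k.*2.+1) / (k.*2.+1)`!%:R))//.
apply/funext => n /=; rewrite 2!muln2 doubleS big_nat_recl ?leqnSn//.
have e1 : (- x) ^+ n.*2 = x ^+ n.*2 by rewrite -!muln2 mulnC !exprM sqrrN.
have e2 : (- x) ^+ n.*2.+1 = - x ^+ n.*2.+1 by rewrite !exprS e1 mulNr.
rewrite big_nat1 /f e1 e2; set u := x ^+ _; set v := x ^+ _.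
by ring.
Qed.

(** Termwise integration is Tonelli for series: for s, y >= 0 all odd terms are nonnegative. The
    moments of s^(b-1) e^{-s} are Gamma(b + 2k + 1), which gives the Pochhammer coefficients. *)
Lemma powR_sub_powR_series b y : 0 < b -> 0 <= y < 1 ->
  (\sum_(k <oo) (2 * poch b (k.*2.+1) / (k.*2.+1)`!%:R * y ^+ (k.*2.+1))%:E)%E =
  ((1 - y) `^ (- b) - (1 + y) `^ (- b))%:E.
Proof.
move=> b0 /andP[y0 y1].
pose T k (s : R) := 2 * (s * y) ^+ (k.*2.+1) / (k.*2.+1)`!%:R * (s `^ (b - 1) * expR (- s)).
have T0 k (s : R) : 0 <= s -> 0 <= T k s.
  move=> s0; rewrite /T mulr_ge0 ?divr_ge0 ?mulr_ge0 ?exprn_ge0 ?powR_ge0 ?expR_ge0//.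
  by rewrite mulr_ge0.
have mT k : measurable_fun setT (T k) by rewrite /T; meas.
have TE k : (\int[mu]_(s in `[0%R, +oo[) (T k s)%:E)%E =
    ((2 * poch b (k.*2.+1) / (k.*2.+1)`!%:R * y ^+ (k.*2.+1)) * Gamma b)%:E.
  have c0 : 0 <= 2 * y ^+ (k.*2.+1) / (k.*2.+1)`!%:R.
    by rewrite divr_ge0// mulr_ge0// exprn_ge0.
  transitivity (\int[mu]_(s in `[0%R, +oo[)
      ((2 * y ^+ (k.*2.+1) / (k.*2.+1)`!%:R)%:E *
      (s `^ (b + (k.*2.+1)%:R - 1) * expR (- s))%:E))%E.
    rewrite -integral_itv_obnd_cbnd; last by apply/measurable_funTS/measurable_EFinP; exact: mT.
    rewrite -[RHS]integral_itv_obnd_cbnd; last first.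
      by apply/measurable_funTS/emeasurable_funM; apply/measurable_EFinP; meas.
    apply: eq_integral => s; rewrite inE/= in_itv/= andbT => s0.
    rewrite -EFinM; congr EFin; rewrite /T.
    rewrite addrAC (powRD (r := b - 1)); last by rewrite (gt_eqF s0) implybT.
    rewrite powR_mulrn ?(ltW s0)// exprMn.
    by set u := s `^ _; set v := expR _; set n := _.+1; ring.
  rewrite ge0_integralZl//; last 2 first.
  - by apply/measurable_funTS/measurable_EFinP; meas.
  - by move=> s _; rewrite lee_fin mulr_ge0 ?powR_ge0 ?expR_ge0.
  have bk0 : 0 < b + (k.*2.+1)%:R by exact: ltr_wpDr.
  rewrite -/(gammae _) (gammaeE _ bk0) -EFinM; congr EFin.
  have f0 : (k.*2.+1)`!%:R != 0 :> R by rewrite pnatr_eq0 -lt0n fact_gt0.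
  have Gb0 : Gamma b != 0 by rewrite gt_eqF// Gamma_gt0.
  rewrite /poch; set F := _`!%:R in f0 *; set Y := y ^+ _; set G := Gamma (b + _).
  by field; rewrite f0.
(* Written as a sum so that every term is nonnegative and additivity holds with the series still
   possibly infinite; the finite left side rules that out at the end. *)
have GE : (((1 - y) `^ (- b))%:E * gammae b =
    ((1 + y) `^ (- b))%:E * gammae b + \sum_(k <oo) \int[mu]_(s in `[0%R, +oo[) (T k s)%:E)%E.
  rewrite -!integral_powR_expR; [|lra|lra].
  rewrite -integral_nneseries//; last 2 first.
  - by move=> k; apply/measurable_funTS/measurable_EFinP; exact: mT.
  - by move=> k s; rewrite /= in_itv/= andbT lee_fin; exact: T0.
  have TS (s : R) : 0 <= s -> (\sum_(k <oo) (T k s)%:E)%E =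
      (s `^ (b - 1) * expR (- ((1 - y) * s)) - s `^ (b - 1) * expR (- ((1 + y) * s)))%:E.
    move=> s0; apply: nneseries_EFin_cvg.
    rewrite (_ : series _ = series (fun k => 2 * (s * y) ^+ (k.*2.+1) / (k.*2.+1)`!%:R) \*
        cst (s `^ (b - 1) * expR (- s))); last first.
      by apply/funext => n; rewrite /series/= mulr_suml.
    rewrite [X in _ --> X](_ : _ = (expR (s * y) - expR (- (s * y))) * (s `^ (b - 1) * expR (- s))).
      by apply: cvgMl; exact: expR_sub_expRN_series.
    rewrite (_ : - ((1 - y) * s) = - s + s * y); last by ring.
    rewrite (_ : - ((1 + y) * s) = - s - s * y); last by ring.
    by rewrite !expRD; ring.
  rewrite -ge0_integralD//; last 4 first.
  - by move=> s _; rewrite lee_fin mulr_ge0 ?powR_ge0 ?expR_ge0.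
  - by apply/measurable_funTS/measurable_EFinP; meas.
  - move=> s; rewrite /= in_itv/= andbT => s0; apply: nneseries_ge0 => k _ _.
    by rewrite lee_fin T0.
  - apply: ge0_emeasurable_sum => //.
    + by move=> k s; rewrite /= in_itv/= andbT => s0 _; rewrite lee_fin T0.
    + by move=> k _; apply/measurable_funTS/measurable_EFinP; exact: mT.
  apply: eq_integral => s; rewrite inE/= in_itv/= andbT => s0.
  by rewrite TS// -EFinD; congr EFin; ring.
move: GE; under eq_eseriesr do rewrite TE.
under eq_eseriesr do rewrite EFinM muleC.
rewrite nneseriesZl; last first.
  move=> k _; rewrite lee_fin mulr_ge0 ?exprn_ge0// divr_ge0// mulr_ge0// ltW// poch_gt0//.
set S := (\sum_(k <oo) _)%E; have S0 : (0 <= S)%E.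
  by apply: nneseries_ge0 => k _ _; rewrite lee_fin mulr_ge0 ?exprn_ge0// divr_ge0// mulr_ge0// ltW// poch_gt0.
have G0 := Gamma_gt0 _ b0.
rewrite gammaeE//; case: S S0 => [r _|_|//].
  rewrite -!EFinM -EFinD => -[h]; congr EFin; apply: (mulfI (lt0r_neq0 G0)).
  apply: (addrI ((1 + y) `^ (- b) * Gamma b)); rewrite -h.
  by set p := _ `^ _; set q := _ `^ _; ring.
by rewrite gt0_muley ?lte_fin//.
Qed.

End Series.

(** * Wallis integrals of odd powers of the cosine *)

Section Cos.
Context {R : realType}.
Local Notation mu := (@lebesgue_measure R).
Lemma derive_sin_cosX n (t : R) : is_derive t 1 (fun t => sin t * cos t ^+ n.+2)
  (n.+3%:R * cos t ^+ n.+3 - n.+2%:R * cos t ^+ n.+1).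
Proof.
pose m := n.+1; rewrite -/m.
have dX : is_derive t 1 (fun t => cos t ^+ m.+1) (m.+1%:R * cos t ^+ m * - sin t).
  have := @is_deriveX _ _ (@cos R) m.+1 t 1 (- sin t) (is_derive_cos t).
  by rewrite exprfctE.
apply: (@is_derive_eq _ _ _ _ _ _ _ _ (is_deriveM (is_derive_sin t) dX)).
rewrite /GRing.scale/= (_ : sin t * _ = - (m.+1%:R * cos t ^+ m * sin t ^+ 2)); last by ring.
rewrite sin2cos2 !exprS -(natr1 m.+1); ring.
Qed.

(** The Wallis value on [0, pi/2], carried by an explicit primitive so that the fundamental theorem
    applies directly. The recursion solves [derive_sin_cosX] for the higher power; sin t cos^(2k+2)
    t vanishes at both endpoints. *)
Lemma primitive_cos_odd k : exists F : R -> R,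
  [/\ forall t, has_derive F t (cos t ^+ (k.*2.+1)), F 0 = 0 &
      F (pi / 2) = k`!%:R / poch (3 / 2) k].
Proof.
elim: k => [|k [F [dF F0 Fpi]]].
  exists sin; split; [move=> t| exact: sin0|].
    by rewrite /has_derive expr1; exact: is_derive_sin.
  by rewrite sin_pihalf poch0// divr1.
pose n := k.*2.
have n3 : n.+3%:R != 0 :> R by rewrite pnatr_eq0.
exists (fun t => n.+3%:R^-1 * (sin t * cos t ^+ n.+2 + n.+2%:R * F t)); split.
- move=> t; have dFt : is_derive t 1 F (cos t ^+ n.+1) := dF t.
  have dS := derive_sin_cosX n t.
  rewrite /has_derive doubleS -/n.
  have dG := is_deriveD dS (is_deriveZ n.+2%:R dFt).
  apply: (@is_derive_eq _ _ _ _ _ _ _ _ (is_deriveZ n.+3%:R^-1 dG)).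
  rewrite /GRing.scale/= subrK mulrA mulVf// mul1r//.
- by rewrite sin0 mul0r F0 mulr0 addr0 mulr0.
- rewrite sin_pihalf cos_pihalf expr0n/= Fpi pochS; last lra.
  have p0 : poch (3 / 2 : R) k != 0 by rewrite gt_eqF// poch_gt0//; lra.
  have -> : n.+3%:R = 2 * (3 / 2 + k%:R) :> R.
    by rewrite /n -muln2 -!natr1 natrM; field.
  have -> : n.+2%:R = 2 * k.+1%:R :> R.
    by rewrite /n -muln2 -!natr1 natrM; ring.
  have q0 : 3 / 2 + k%:R != 0 :> R by rewrite gt_eqF// ltr_wpDr//; lra.
  rewrite factS natrM; set u := k.+1%:R; set v := k`!%:R; set p := poch _ _ in p0 *; set q := _ + _ in q0 *.
  by rewrite mulr0 add0r; field; rewrite p0 q0.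
Qed.
End Cos.

(** * From the folded integral to the hypergeometric bound *)

Section Hypergeometric.
Context {R : realType}.
Local Notation mu := (@lebesgue_measure R).
Implicit Types (a b x r : R).

Lemma poch_succ b k : 0 < b -> poch b k.+1 = b * poch (b + 1) k.
Proof.
move=> b0; have b1 : 0 < b + 1 by rewrite addr_gt0.
elim: k => [|k ih]; first by rewrite pochS// !poch0// addr0 mulr1 mul1r.
by rewrite pochS// ih pochS// -mulrA -addrA nat1r.
Qed.

(** Separates the factors b + 2j from the factors b + 2j + 1. Applied to b = 2 + a/2 it yields the
    upper parameters 1 + a/4 and 3/2 + a/4. *)
Lemma poch_double b k : 0 < b ->
  poch b k.*2 = 4 ^+ k * poch (b / 2) k * poch ((b + 1) / 2) k.
Proof.
move=> b0; elim: k => [|k ih]; first by rewrite !poch0// ?divr_gt0 ?addr_gt0// expr0 !mulr1.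
rewrite doubleS !pochS ?divr_gt0 ?addr_gt0// ih exprS.
rewrite -(natr1 k.*2) -muln2 natrM.
by set u := poch _ _; set v := poch _ _; set w := 4 ^+ k; field.
Qed.

Lemma fact_odd k : (k.*2.+1)`!%:R = 4 ^+ k * k`!%:R * poch (3 / 2) k :> R.
Proof.
elim: k => [|k ih]; first by rewrite poch0 ?divr_gt0// expr0 !mulr1.
rewrite doubleS factS factS natrM natrM ih pochS ?divr_gt0// exprS factS natrM.
rewrite -(natr1 k.*2.+2) -(natr1 k.*2.+1) -(natr1 k.*2) -(natr1 k) -muln2 natrM.
by set u := poch _ _; set w := 4 ^+ k; set v := _`!%:R; field.
Qed.

Definition hyp_term a x k : R := poch 1 k * poch (1 + a / 4) k * poch (3 / 2 + a / 4) k
  / (poch (3 / 2) k * poch (3 / 2) k * k`!%:R) * x ^+ k.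

(** Series coefficient times Wallis integral. One (3/2)_k comes from (2k+1)!, the other from the
    Wallis value; the upper parameter 1 compensates the k! built into a hypergeometric series. *)
Lemma hyp_coefE a x k : -1 < a ->
  2 * poch (1 + a / 2) (k.*2.+1) / (k.*2.+1)`!%:R * x ^+ (k.*2.+1) * (k`!%:R / poch (3 / 2) k) =
  2 * (1 + a / 2) * x * hyp_term a (x ^+ 2) k.
Proof.
move=> a1.
have h0 : 0 < 1 + a / 2 by lra.
have p0 : poch (3 / 2 : R) k != 0 by rewrite gt_eqF// poch_gt0//; lra.
have f0 : k`!%:R != 0 :> R by rewrite pnatr_eq0 -lt0n fact_gt0.
have w0 : 4 ^+ k != 0 :> R by rewrite expf_neq0.
have h1 : 0 < 1 + a / 2 + 1 by lra.
rewrite poch_succ// poch_double// fact_odd /hyp_term poch1.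
rewrite (_ : (1 + a / 2 + 1) / 2 = 1 + a / 4); last by field.
rewrite (_ : (1 + a / 2 + 1 + 1) / 2 = 3 / 2 + a / 4); last by field.
rewrite exprS -muln2 mulnC exprM.
set p := poch (3 / 2) k in p0 *; set u := poch _ _; set v := poch _ _; set F := k`!%:R in f0 *.
set w := 4 ^+ k in w0 *; set X := _ ^+ k.
by field; rewrite p0 f0.
Qed.

Lemma hyp_term_ge0 a x k : -1 < a -> 0 <= x -> 0 <= hyp_term a x k.
Proof.
move=> a1 x0.
have p1 : 0 < poch (1 + a / 4) k by apply: poch_gt0; lra.
have p2 : 0 < poch (3 / 2 + a / 4) k by apply: poch_gt0; lra.
have p3 : 0 < poch (3 / 2 : R) k by apply: poch_gt0; lra.
have p4 : 0 < poch (1 : R) k by exact: poch_gt0.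
have p5 : 0 < k`!%:R :> R by rewrite ltr0n fact_gt0.
apply: mulr_ge0; last exact: exprn_ge0.
apply: ltW; exact: (divr_gt0 (mulr_gt0 (mulr_gt0 p4 p1) p2) (mulr_gt0 (mulr_gt0 p3 p3) p5)).
Qed.

Lemma cos_ge0_quadrant (t : R) : 0 <= t <= pi / 2 -> 0 <= cos t.
Proof.
move=> /andP[t0 t1]; apply: cos_ge0_pihalf; rewrite t1 andbT.
by have := pi_gt0 R; lra.
Qed.

Lemma integral_powR_cos_hyp a x : -1 < a -> 0 <= x < 1 ->
  (\int[mu]_(t in `[0%R, (pi / 2)%R])
     ((1 - x * cos t) `^ (- (1 + a / 2)) - (1 + x * cos t) `^ (- (1 + a / 2)))%:E =
  (2 * (1 + a / 2) * x * limn (series (hyp_term a (x ^+ 2))))%:E)%E.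
Proof.
move=> a1 /andP[x0 x1]; set be := 1 + a / 2.
have be0 : 0 < be by rewrite /be; lra.
have pi0 := pi_gt0 R.
have mcos : measurable_fun setT (@cos R) by apply: continuous_measurable_fun; exact: continuous_cos.
have dom (t : R) : 0 <= t <= pi / 2 -> 0 <= x * cos t <= x.
  move=> h; rewrite mulr_ge0 ?cos_ge0_quadrant//=.
  by rewrite -[leRHS]mulr1 ler_wpM2l// cos_le1.
(* The case x = 0 is separate because convergence of the hypergeometric series is obtained below by
   dividing by [2 * be * x]. *)
have [->|xn0] := eqVneq x 0.
  by rewrite mulr0 mul0r integral0_eq// => t _; rewrite !mul0r subr0 addr0 subrr.
have xp : 0 < x by rewrite lt_neqAle eq_sym xn0.
pose c k := 2 * poch be (k.*2.+1) / (k.*2.+1)`!%:R.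
have c0 k : 0 <= c k by rewrite divr_ge0// mulr_ge0// ltW// poch_gt0.
set I := integral _ _ _.
have IS : I = (\sum_(k <oo) (2 * be * x * hyp_term a (x ^+ 2) k)%:E)%E.
  transitivity (\int[mu]_(t in `[0%R, (pi / 2)%R]) \sum_(k <oo) (c k * (x * cos t) ^+ k.*2.+1)%:E)%E.
    apply: eq_integral => t; rewrite inE/= in_itv/= => /dom/andP[y0 y1].
    by rewrite powR_sub_powR_series// y0 (le_lt_trans y1).
  rewrite integral_nneseries//; last 2 first.
  - by move=> k; apply/measurable_funTS/measurable_EFinP; meas.
  - move=> k t; rewrite /= in_itv/= => /dom/andP[y0 y1].
    by rewrite lee_fin mulr_ge0// exprn_ge0.
  apply: eq_eseriesr => k _.
  rewrite -hyp_coefE// -/be -/(c k).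
  have [F [dF F0 Fpi]] := @primitive_cos_odd R k.
  transitivity (\int[mu]_(t in `[0%R, (pi / 2)%R]) ((c k * x ^+ k.*2.+1)%:E * (cos t ^+ k.*2.+1)%:E))%E.
    by apply: eq_integral => t _; rewrite -EFinM exprMn mulrA.
  rewrite ge0_integralZl//; last 3 first.
  - by apply/measurable_funTS/measurable_EFinP; meas.
  - by move=> t; rewrite /= in_itv/= => /cos_ge0_quadrant h; rewrite lee_fin exprn_ge0.
  - by rewrite lee_fin mulr_ge0// exprn_ge0.
  rewrite (@integral_derive_cc _ _ F)//; last 2 first.
  - by rewrite divr_gt0.
  - by move=> t _; have := @is_deriveX _ _ (@cos R) k.*2.+1 t 1 _ (is_derive_cos t); rewrite exprfctE; exact: is_derive_continuous.
  by rewrite F0 subr0 Fpi -EFinM.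
have I0 : (0 <= I)%E.
  rewrite IS; apply: nneseries_ge0 => k _ _.
  by rewrite lee_fin mulr_ge0 ?hyp_term_ge0 ?sqr_ge0// !mulr_ge0// ltW.
(* The integrand is bounded by (1 - x)^(-be); this finiteness is what makes the hypergeometric
   series converge. *)
have Ioo : (I < +oo)%E.
  apply: (@le_lt_trans _ _ (\int[mu]_(t in `[0%R, (pi / 2)%R]) ((1 - x) `^ (- be))%:E)%E).
    apply: ge0_le_integral => //.
    - move=> t; rewrite /= in_itv/= => /dom/andP[y0 y1].
      rewrite lee_fin subr_ge0 !powRN lef_pV2 ?posrE ?powR_gt0//; [|lra|lra].
      by apply: ge0_ler_powR; rewrite ?nnegrE; lra.
    - by apply/measurable_funTS/measurable_EFinP; meas.
    - move=> t; rewrite /= in_itv/= => /dom/andP[y0 y1].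
      rewrite lee_fin (@le_trans _ _ ((1 - x * cos t) `^ (- be)))//.
        by rewrite gerBl powR_ge0.
      rewrite !powRN lef_pV2 ?posrE ?powR_gt0//; [|lra|lra].
      by apply: ge0_ler_powR; rewrite ?nnegrE; lra.
  by rewrite integral_cst//= lebesgue_measure_itv/= lte_fin divr_gt0// -EFinB -EFinM ltry.
have Ifin : I \is a fin_num by rewrite ge0_fin_numE.
have := @cvg_series_nneseries R (fun k => 2 * be * x * hyp_term a (x ^+ 2) k) (fine I).
rewrite fineK// -IS => /(_ _ erefl) cv.
have K0 : 2 * be * x != 0 by rewrite !mulf_neq0// gt_eqF.
have {}cv : series (hyp_term a (x ^+ 2)) @ \oo --> (2 * be * x)^-1 * fine I.
  have -> : series (hyp_term a (x ^+ 2)) = (fun n => (2 * be * x)^-1 * series (fun k => 2 * be * x * hyp_term a (x ^+ 2) k) n).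
    by apply/funext => n; rewrite /series/= -mulr_sumr mulrA mulVf// mul1r.
  apply: cvgMr; apply: cv => k.
  by rewrite mulr_ge0 ?hyp_term_ge0 ?sqr_ge0// !mulr_ge0// ltW.
by rewrite (cvg_lim _ cv)// mulrA divff// mul1r fineK.
Qed.

(** Pulling (1 + r^2)^(-(1 + a/2)) out of both powers leaves 1 -+ x cos t with x = 2r/(1 + r^2),
    whose square is the hypergeometric argument; x < 1 because (1 - r)^2 > 0. *)
Lemma bound_rhs_integral a r : -1 < a -> 0 <= r < 1 ->
  (bound_rhs a r)%:E = ((c_alpha a * (1 - r ^+ 2) `^ (a + 1) / pi)%:E *
    \int[mu]_(t in `[0%R, (pi / 2)%R])
      ((1 + r ^+ 2 - 2 * r * cos t) `^ (- (1 + a / 2)) -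
       (1 + r ^+ 2 + 2 * r * cos t) `^ (- (1 + a / 2)))%:E)%E.
Proof.
move=> a1 /andP[r0 r1].
have s0 : 0 < 1 + r ^+ 2 by rewrite ltr_wpDr// sqr_ge0.
pose x := 2 * r / (1 + r ^+ 2).
have x0 : 0 <= x by rewrite divr_ge0 ?mulr_ge0// ltW.
have x1 : x < 1 by rewrite ltr_pdivrMr// mul1r; nra.
have xe : x * (1 + r ^+ 2) = 2 * r by rewrite /x divfK// gt_eqF.
have mcos : measurable_fun setT (@cos R) by apply: continuous_measurable_fun; exact: continuous_cos.
have dom (t : R) : 0 <= t <= pi / 2 -> 0 <= x * cos t <= x.
  move=> h; rewrite mulr_ge0 ?cos_ge0_quadrant//=.
  by rewrite -[leRHS]mulr1 ler_wpM2l// cos_le1.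
set be := 1 + a / 2.
transitivity ((c_alpha a * (1 - r ^+ 2) `^ (a + 1) / pi)%:E *
    \int[mu]_(t in `[0%R, (pi / 2)%R]) (((1 + r ^+ 2) `^ (- be))%:E *
     ((1 - x * cos t) `^ (- be) - (1 + x * cos t) `^ (- be))%:E))%E; last first.
  congr (_ * _)%E; apply: eq_integral => t; rewrite inE/= in_itv/= => /dom/andP[y0 y1].
  rewrite -EFinM; congr EFin; rewrite mulrBr -!powRM ?(ltW s0)//; [|lra|lra].
  congr (_ `^ _ - _ `^ _).
    by rewrite mulrBr mulr1 -xe; ring.
  by rewrite mulrDr mulr1 -xe; ring.
have be0 : 0 < be by rewrite /be; lra.
rewrite ge0_integralZl//; last 3 first.
- by apply/measurable_funTS/measurable_EFinP; meas.
- move=> t; rewrite /= in_itv/= => /dom/andP[y0 y1].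
  rewrite lee_fin subr_ge0 !powRN lef_pV2 ?posrE ?powR_gt0//; [|lra|lra].
  by apply: ge0_ler_powR; rewrite ?nnegrE; lra.
- by rewrite lee_fin powR_ge0.
rewrite integral_powR_cos_hyp ?x0// -!EFinM; congr EFin.
rewrite /bound_rhs /c_alpha /hyp3F2 (_ : 4 * r ^+ 2 / (1 + r ^+ 2) ^+ 2 = x ^+ 2); last first.
  by rewrite /x; field; exact: lt0r_neq0.
rewrite -[limn _]/(limn (series (hyp_term a (x ^+ 2)))).
(* The extra factor 1 + r^2 is the denominator of the x in front of the series. *)
rewrite (_ : 2 + a / 2 = be + 1); last by rewrite /be; ring.
rewrite (powRD (r := be)); last by rewrite (gt_eqF s0) implybT.
rewrite powRr1 ?(ltW s0)// powRN (addrC 1 a) -/be.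
have q0 : (1 + r ^+ 2) `^ be != 0 by rewrite gt_eqF// powR_gt0.
have s1 : 1 + r ^+ 2 != 0 by rewrite gt_eqF.
have g0 : Gamma (a + 1) != 0 by rewrite gt_eqF// Gamma_gt0//; lra.
have pi0 : pi != 0 :> R by rewrite gt_eqF// pi_gt0.
have -> : 2 + a = 2 * be by rewrite /be; field.
set L := limn _; set q := _ `^ be in q0 *; set s := 1 + r ^+ 2 in s1 *; set P := (1 - _) `^ _.
set G := Gamma (a + 1) in g0 *; set H := Gamma be.
rewrite /x -/s; set p := pi in pi0 *; clearbody p.
by field; rewrite s1 q0 g0 pi0.
Qed.

Lemma atan_double r : 0 <= r < 1 -> 2 * atan r = atan (2 * r / (1 - r ^+ 2)).
Proof.
move=> /andP[r0 r1].
have a0 : 0 <= atan r by rewrite -(@atan0 R) le_atan.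
have a1 : atan r < pi / 4 by rewrite -(@atan1 R) lt_atan.
have c0 : cos (atan r) != 0 by rewrite cos_atan invr_neq0// gt_eqF// sqrtr_gt0 ltr_wpDr// sqr_ge0.
rewrite -[LHS]tanK; last by rewrite in_itv/=; apply/andP; split; have := pi_gt0 R; lra.
by rewrite mulr_natl tan_mulr2n// atanK -mulr_natl.
Qed.

(** At a = 0 the integral form is elementary. The two denominators multiply to (1 - r^2)^2 (1 + q^2
    sin^2 t) with q = 2r/(1 - r^2) = tan(2 atan r), so atan(q sin t) is a primitive up to a constant
    factor. *)
Lemma bound_rhs_atan r : 0 <= r < 1 -> bound_rhs 0 r = 4 / pi * atan r.
Proof.
move=> r01; have /andP[r0 r1] := r01; apply: EFin_inj.
have pi0 := pi_gt0 R.
have d0 : 0 < 1 - r ^+ 2 by nra.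
pose q := 2 * r / (1 - r ^+ 2).
rewrite bound_rhs_integral// /c_alpha mul0r addr0 Gamma1 expr1n divr1 mul1r add0r powRr1 ?(ltW d0)//.
have den (t : R) : 1 + (q * sin t) ^+ 2 != 0 by rewrite gt_eqF// ltr_wpDr// sqr_ge0.
rewrite (eq_integral (fun t : measurableTypeR R => (2 / (1 - r ^+ 2) * (q * cos t / (1 + (q * sin t) ^+ 2)))%:E)); last first.
  move=> t; rewrite inE/= in_itv/= => /cos_ge0_quadrant ct; congr EFin.
  have ct1 := cos_le1 t.
  have p1 : 0 < 1 + r ^+ 2 - 2 * r * cos t by nra.
  have p2 : 0 < 1 + r ^+ 2 + 2 * r * cos t by nra.
  rewrite !powR_inv1 ?ltW//.
  have E1 : (1 + r ^+ 2 - 2 * r * cos t) * (1 + r ^+ 2 + 2 * r * cos t) =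
      (1 - r ^+ 2) ^+ 2 * (1 + (q * sin t) ^+ 2).
    rewrite exprMn sin2cos2 /q; field; exact: lt0r_neq0.
  rewrite (_ : _^-1 - _^-1 = 4 * r * cos t / ((1 + r ^+ 2 - 2 * r * cos t) * (1 + r ^+ 2 + 2 * r * cos t))); last first.
    by field; rewrite !gt_eqF.
  rewrite E1; set D := 1 + (q * _) ^+ 2; have D0 : D != 0 by exact: den.
  by rewrite /q; field; rewrite D0 gt_eqF.
rewrite (@integral_derive_cc _ _ (fun t => 2 / (1 - r ^+ 2) * atan (q * sin t)))//.
- rewrite sin_pihalf sin0 mulr1 mulr0 atan0 mulr0 subr0 -EFinM; congr EFin.
  rewrite -atan_double//; set p := pi in pi0 *; clearbody p.
  by field; rewrite !gt_eqF.
- by rewrite divr_gt0.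
- move=> t _; apply: (@continuousM _ _ (cst (2 / (1 - r ^+ 2)))); first exact: cst_continuous.
  apply: (@continuousM _ _ (fun t => q * cos t)); first exact: is_derive_continuous.
  apply: (@continuousV _ _ (fun t => 1 + (q * sin t) ^+ 2) t (den t)).
  exact: is_derive_continuous.
- move=> t _; rewrite /has_derive; apply: is_derive_eq.
  by rewrite /GRing.scale/=; congr (_ * _); rewrite mulrC.
Qed.

End Hypergeometric.

(** * Elementary estimates for the kernel *)

Section Kernel.
Context {R : realType}.
Local Notation mu := (@lebesgue_measure R).
Implicit Types (a r y t s m u v : R).

Lemma bounded_integrable (f : R -> R) (a b C : R) : measurable_fun setT f ->
  (forall t, a <= t <= b -> `|f t| <= C) -> mu.-integrable `[a, b] (EFin \o f).
Proof.
move=> mf fC; apply: measurable_bounded_integrable => //.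
- have [ab|ba] := leP a b.
    by rewrite /= lebesgue_measure_itv/= lte_fin; case: ifP => _; rewrite -?EFinB ltry.
  by rewrite set_itv_ge ?measure0// bnd_simp -ltNge.
- exact: measurable_funTS.
- exists C; split; first exact: num_real.
  by move=> x Cx t /=; rewrite in_itv/= => /fC h; exact: le_trans (ltW Cx).
Qed.

(** The kernel as a function of the cosine y of the angle between t and arg z. Thus [kern a r 0] is
    its value at a right angle, the constant kappa. *)
Definition kern a r y : R :=
  c_alpha a * (1 - r ^+ 2) `^ (a + 1) * (1 + r ^+ 2 - 2 * r * y) `^ (- (1 + a / 2)).

Lemma c_alpha_gt0 a : -1 < a -> 0 < c_alpha a.
Proof. by move=> a1; rewrite divr_gt0 ?exprn_gt0// Gamma_gt0//; lra. Qed.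

Lemma kern_ge0 a r y : -1 < a -> 0 <= kern a r y.
Proof. by move=> a1; exact: (mulr_ge0 (mulr_ge0 (ltW (c_alpha_gt0 _ a1)) (powR_ge0 _ _)) (powR_ge0 _ _)). Qed.

Lemma measurable_kern a r : measurable_fun setT (kern a r).
Proof. by rewrite /kern; meas. Qed.

Lemma measurable_cos : measurable_fun setT (@cos R).
Proof. by apply: continuous_measurable_fun; exact: continuous_cos. Qed.

Lemma kern_den_ge r y : 0 <= r -> y <= 1 -> (1 - r) ^+ 2 <= 1 + r ^+ 2 - 2 * r * y.
Proof. by move=> r0 y1; nra. Qed.

(** Here 2 - 2y is the squared chord between e^{it} and e^{is}. The chord is at most |e^{it} - r
    e^{is}| + (1 - r), hence at most twice |e^{it} - r e^{is}|. The bound is uniform in r. *)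
Lemma kern_den_ge_chord r y : 0 <= r <= 1 -> -1 <= y <= 1 ->
  (2 - 2 * y) / 4 <= 1 + r ^+ 2 - 2 * r * y.
Proof.
move=> /andP[r0 r1] /andP[y0 y1]; rewrite -subr_ge0.
have -> : 1 + r ^+ 2 - 2 * r * y - (2 - 2 * y) / 4 =
  (1 + y) / 2 * (1 - r) ^+ 2 + (1 - y) / 2 * (r ^+ 2 + 2 * r) by field.
rewrite addr_ge0// mulr_ge0 ?sqr_ge0 ?addr_ge0 ?mulr_ge0 ?sqr_ge0 ?invr_ge0//; lra.
Qed.

Lemma powR_den_le (p m u : R) : 0 <= p -> 0 < m -> m <= u -> u `^ (- p) <= m `^ (- p).
Proof.
move=> p0 m0 mu'; have u0 : 0 < u by exact: lt_le_trans mu'.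
rewrite !powRN lef_pV2 ?posrE ?powR_gt0//.
by apply: ge0_ler_powR; rewrite ?nnegrE ?(ltW m0) ?(ltW u0).
Qed.

Definition kern_max a r : R := c_alpha a * (1 - r ^+ 2) `^ (a + 1) * ((1 - r) ^+ 2) `^ (- (1 + a / 2)).

Lemma kern_le_max a r y : -1 < a -> 0 <= r < 1 -> y <= 1 -> kern a r y <= kern_max a r.
Proof.
move=> a1 /andP[r0 r1] y1; rewrite /kern /kern_max ler_wpM2l//.
  exact: (mulr_ge0 (ltW (c_alpha_gt0 _ a1)) (powR_ge0 _ _)).
apply: powR_den_le; [lra| |exact: kern_den_ge].
by rewrite exprn_gt0// subr_gt0.
Qed.

Lemma powR_lipschitz (p m u v : R) : 0 < p -> 0 < m -> m <= u -> m <= v ->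
  `|u `^ (- p) - v `^ (- p)| <= p * m `^ (- (p + 1)) * `|u - v|.
Proof.
move=> p0 m0; wlog uv : u v / u <= v.
  move=> h mu' mv'; have [uv|/ltW vu] := leP u v; first exact: h.
  by rewrite distrC (distrC u v); exact: h.
move=> mu' mv'; have u0 : 0 < u by exact: lt_le_trans mu'.
have [|c| c] := @MVT_segment R (fun t => t `^ (- p)) (fun t => - p * t `^ (- p - 1)) u v uv.
- by move=> x; rewrite in_itv/= => /andP[ux _]; apply: is_derive1_powR; exact: lt_trans ux.
- apply: continuous_in_subspaceT => x; rewrite inE/= in_itv/= => /andP[ux _].
  by apply: powR_continuous; exact: lt_le_trans ux.
rewrite in_itv/= => /andP[uc cv] e.
rewrite distrC e (distrC u v) normrM ler_wpM2r ?normr_ge0//.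
rewrite mulNr normrN ger0_norm ?mulr_ge0 ?powR_ge0 ?(ltW p0)// ler_wpM2l ?(ltW p0)//.
rewrite (_ : - p - 1 = - (p + 1)); last by ring.
by apply: powR_den_le => //; [rewrite addr_ge0// ltW|exact: le_trans uc].
Qed.

Lemma kern_lipschitz a r : -1 < a -> 0 <= r < 1 -> exists2 L : R, 0 <= L &
  forall y y' : R, y <= 1 -> y' <= 1 -> `|kern a r y - kern a r y'| <= L * `|y - y'|.
Proof.
move=> a1 /andP[r0 r1]; have c0 := ltW (c_alpha_gt0 _ a1).
pose p := 1 + a / 2; have p0 : 0 < p by rewrite /p; lra.
pose K := c_alpha a * (1 - r ^+ 2) `^ (a + 1).
have K0 : 0 <= K by exact: (mulr_ge0 c0 (powR_ge0 _ _)).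
exists (K * (p * ((1 - r) ^+ 2) `^ (- (p + 1)) * (2 * r))).
  exact: (mulr_ge0 K0 (mulr_ge0 (mulr_ge0 (ltW p0) (powR_ge0 _ _)) (mulr_ge0 (ler0n _ 2) r0))).
move=> y y' y1 y1'; rewrite /kern -/K -/p -mulrBr normrM (ger0_norm K0) -(mulrA K); apply: ler_wpM2l => //.
have m0 : 0 < (1 - r) ^+ 2 by rewrite exprn_gt0// subr_gt0.
apply: le_trans (powR_lipschitz _ _ _ _ p0 m0 (kern_den_ge _ _ r0 y1) (kern_den_ge _ _ r0 y1')) _.
have -> : 1 + r ^+ 2 - 2 * r * y - (1 + r ^+ 2 - 2 * r * y') = (2 * r) * (y' - y) by ring.
by rewrite normrM (@ger0_norm _ (2 * r)) ?mulr_ge0// (distrC y') !mulrA.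
Qed.

Lemma cnorm_polar r s : 0 <= r -> cnorm (r * cos s, r * sin s) = r.
Proof.
by move=> r0; rewrite /cnorm/= !exprMn -mulrDr cos2Dsin2 mulr1 sqrtr_sqr ger0_norm.
Qed.

Lemma KalphaE a r s t : 0 <= r -> Kalpha a (r * cos s, r * sin s) t = kern a r (cos (t - s)).
Proof.
move=> r0; rewrite /Kalpha /kern cnorm_polar// -powRN; congr (_ * _).
rewrite /cnorm/= -powR12_sqrt ?addr_ge0 ?sqr_ge0// -powRrM.
congr (_ `^ _); last by field.
have e1 := cos2Dsin2 t; have e2 := cos2Dsin2 s.
rewrite cosB.
transitivity (((cos t) ^+ 2 + (sin t) ^+ 2) + r ^+ 2 * ((cos s) ^+ 2 + (sin s) ^+ 2)
   - 2 * r * (cos t * cos s + sin t * sin s)); first by ring.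
by rewrite e1 e2 mulr1.
Qed.

Lemma one_sub_cos_le t : 0 <= t <= pi -> 1 - cos t <= t ^+ 2 / 2.
Proof.
move=> /andP[t0 tpi].
have -> : 1 - cos t = 2 * sin (t / 2) ^+ 2.
  have -> : cos t = cos ((t / 2) *+ 2) by congr cos; rewrite -mulr_natr divfK.
  by rewrite cos_mulr2n sin2cos2; ring.
have h0 : 0 <= t / 2 by rewrite divr_ge0.
have s0 : 0 <= sin (t / 2) by apply: sin_ge0_pi; apply/andP; split => //; lra.
have [|c _] := @MVT_segment R (@sin R) (@cos R) 0 (t / 2) h0.
- exact/continuous_subspaceT/continuous_sin.
rewrite sin0 !subr0 => e.
have s1 : sin (t / 2) <= t / 2 by rewrite e; have := cos_le1 c; nra.
by nra.
Qed.

(** The two cosines are the projections of e^{is} and e^{it} on the direction u, and projecting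
    shortens the chord. *)
Lemma cos_dist_le_chord s t u : `|cos (s - u) - cos (t - u)| <= Num.sqrt (2 - 2 * cos (s - t)).
Proof.
have -> : s - t = (s - u) - (t - u) by ring.
set A := s - u; set B := t - u.
rewrite -sqrtr_sqr ler_wsqrtr// cosB.
have e1 := cos2Dsin2 A; have e2 := cos2Dsin2 B.
have -> : 2 - 2 * (cos A * cos B + sin A * sin B) =
   (cos A - cos B) ^+ 2 + (sin A - sin B) ^+ 2.
  by transitivity ((cos A ^+ 2 + sin A ^+ 2) + (cos B ^+ 2 + sin B ^+ 2) - 2 * (cos A * cos B + sin A * sin B)); [rewrite e1 e2; ring|ring].
by rewrite lerDl sqr_ge0.
Qed.

End Kernel.

(** * Mass and concentration of the kernel along the radii 1 - 1/(n+1) *)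

Section BoundaryLimit.
Context {R : realType}.
Local Notation mu := (@lebesgue_measure R).
Local Notation eps n := (n.+1%:R^-1 : R).
Implicit Types (a t : R) (n : nat).

Lemma eps_gt0 n : 0 < eps n. Proof. by rewrite invr_gt0. Qed.

Lemma eps_le1 n : eps n <= 1. Proof. by rewrite invf_le1// ler1n. Qed.

Lemma cvg_eps : eps n @[n --> \oo] --> (0 : R).
Proof. exact: cvg_harmonic. Qed.

(** Zoom at scale e = 1/(n+1): after bounding the denominator by e^2 + t^2, put t = e u. The powers
    e^(a+1), e and e^(-(a+2)) cancel, leaving a truncated Cauchy-type integral. *)
Lemma kern_mass_ge a n : -1 < a ->
  ((2 * c_alpha a * (2 - eps n) `^ (a + 1))%:E *
   \int[mu]_(u in `[0%R, n%:R]) ((1 + u ^+ 2) `^ (- (1 + a / 2)))%:E <=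
   \int[mu]_(t in `[0%R, (2 * pi)%R]) (kern a (1 - eps n) (cos (t - 0)))%:E)%E.
Proof.
move=> a1; have pi0 := pi_gt0 R; have e0 := eps_gt0 n; have e1 := eps_le1 n.
have c0 := c_alpha_gt0 _ a1.
set e := eps n in e0 e1 *; set p := 1 + a / 2.
have K0 : 0 <= c_alpha a * (2 - e) `^ (a + 1) by exact: (mulr_ge0 (ltW c0) (powR_ge0 _ _)).
rewrite (@integral_circle_cos _ (kern a (1 - e)))//; last 3 first.
- exact: measurable_kern.
- by move=> y; exact: kern_ge0.
- by rewrite lexx mulr_ge0// ltW.
rewrite -mulrA EFinM -muleA lee_pmul2l ?lte_fin//.
pose g (t : R) := c_alpha a * (1 - (1 - e) ^+ 2) `^ (a + 1) * (e ^+ 2 + t ^+ 2) `^ (- p).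
have g0 t : 0 <= g t by exact: (mulr_ge0 (mulr_ge0 (ltW c0) (powR_ge0 _ _)) (powR_ge0 _ _)).
have mg : measurable_fun setT g by rewrite /g; meas.
have mk := @measurable_kern R a (1 - e).
apply: (@le_trans _ _ (\int[mu]_(t in `[0%R, pi]) (g t)%:E)%E); last first.
  apply: ge0_le_integral => //.
  - by move=> t _; rewrite lee_fin.
  - by apply/measurable_funTS/measurable_EFinP.
  - by apply: measurable_funTS; exact: (measurable_fun_comp_cos mk).
  - move=> t; rewrite /= in_itv/= => tpi; rewrite lee_fin /g /kern ler_wpM2l//.
      exact: (mulr_ge0 (ltW c0) (powR_ge0 _ _)).
    (* The denominator is e^2 + 2(1 - e)(1 - cos t), which is at most e^2 + t^2. *)
    have ct := one_sub_cos_le _ tpi; have c1 := cos_le1 t.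
    apply: powR_den_le; rewrite ?/p; [lra| |nra].
    by apply: lt_le_trans (@kern_den_ge R (1 - e) (cos t) _ c1); [rewrite exprn_gt0//; lra|lra].
rewrite (@ge0_integral_affine _ e 0 `[0%R, pi]%classic)//; last 2 first.
- by apply/measurable_funTS/measurable_EFinP.
- by move=> t _; rewrite lee_fin.
have mge : measurable_fun setT (fun u => g (e * u + 0)).
  by apply: (@measurableT_comp _ _ _ _ _ _ g) => //; meas.
(* For u <= n one has e u <= n/(n+1) <= 1 <= pi. The window grows with n and in the limit exhausts
   the half line. *)
have sub : `[0%R, n%:R]%classic `<=` ((fun x => e * x + 0) @^-1` `[0%R, pi]%classic).
  move=> u /=; rewrite !in_itv/= addr0 => /andP[u0 un].
  rewrite mulr_ge0 ?(ltW e0)//= (@le_trans _ _ 1)//; last by have := pi_ge2 R; lra.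
  rewrite /e mulrC ler_pdivrMr// mul1r (le_trans un)// ler_nat//.
apply: (@le_trans _ _ (e%:E * \int[mu]_(u in `[0%R, n%:R]) (g (e * u + 0))%:E)%E); last first.
  rewrite lee_pmul2l ?lte_fin//; apply: ge0_subset_integral => //.
  - rewrite (_ : _ @^-1` _ = `[0%R, (pi / e)%R]%classic)//.
    apply/seteqP; split => u /=; rewrite !in_itv/= addr0 pmulr_rge0// ler_pdivlMr// (mulrC u)//.
  - by apply/measurable_funTS/measurable_EFinP.
  - by move=> u _; rewrite lee_fin.
rewrite -ge0_integralZl; [|exact: measurable_itv| | |by rewrite lee_fin]; last 2 first.
- by apply/measurable_funTS/measurable_EFinP; meas.
- by move=> u _; rewrite lee_fin powR_ge0.
rewrite -ge0_integralZl; [|exact: measurable_itv| | |by rewrite lee_fin ltW]; last 2 first.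
- by apply/measurable_funTS/measurable_EFinP.
- by move=> u _; rewrite lee_fin.
rewrite le_eqVlt; apply/orP; left; apply/eqP; apply: eq_integral => u _.
rewrite -!EFinM; congr EFin; rewrite /g addr0.
have en0 : e != 0 by rewrite gt_eqF.
rewrite (_ : 1 - (1 - e) ^+ 2 = e * (2 - e)); last by ring.
rewrite (_ : e ^+ 2 + (e * u) ^+ 2 = e ^+ 2 * (1 + u ^+ 2)); last by ring.
rewrite powRM ?(ltW e0)//; last lra.
rewrite powRM ?sqr_ge0 ?addr_ge0 ?sqr_ge0//.
rewrite -(powR_mulrn 2 (ltW e0)) -powRrM.
have -> : 2%:R * - p = - (1 + (a + 1)) by rewrite /p; field.
have -> : e `^ (- (1 + (a + 1))) = (e * e `^ (a + 1))^-1.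
  by rewrite powRN (powRD (r := 1)) ?en0 ?implybT// powRr1 ?(ltW e0).
have q0 : e `^ (a + 1) != 0 by rewrite gt_eqF// powR_gt0.
set q := e `^ _ in q0 *; set x := (2 - e) `^ _; set y := (1 + _) `^ _; set c := c_alpha a.
by clearbody q x y c e; field; rewrite q0 en0.
Qed.

(** Duplication shows that [c_alpha] is exactly the normalisation for which the limiting mass is 2
    pi. *)
Lemma cauchy_mass_kernel a : -1 < a ->
  ((2 * c_alpha a * 2 `^ (a + 1))%:E * cauchy_mass (1 + a / 2) = (2 * pi)%:E)%E.
Proof.
move=> a1; have pi0 := pi_gt0 R.
have := @Gamma_sqr_cauchy_mass R (1 + a / 2); rewrite (_ : 2 * (1 + a / 2) - 1 = a + 1); last by field.
have h : 2^-1 < 1 + a / 2 by lra.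
move=> /(_ h); have G0 : 0 < Gamma (a + 1) by apply: Gamma_gt0; lra.
have Gb : 0 < Gamma (1 + a / 2) by apply: Gamma_gt0; lra.
have T0 : 0 < 2 `^ (a + 1) :> R by exact: powR_gt0.
rewrite /c_alpha (addrC 1 a); set G := Gamma (a + 1) in G0 *; set H := Gamma _ in Gb *; set T := 2 `^ _ in T0 *.
have := @cauchy_mass_ge0 R (1 + a / 2).
case: cauchy_mass => [J _|_|//]; last by rewrite gt0_muley// lte_fin divr_gt0// mulr_gt0// exprn_gt0.
rewrite -!EFinM => -[e]; congr EFin; move: e; move: (pi : R) pi0 => p p0 e.
have -> : 2 * (H ^+ 2 / G) * T * J = 2 * p / G * (H ^+ 2 * T / p * J).
  by field; rewrite !gt_eqF.
by rewrite e; field; rewrite gt_eqF.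
Qed.

(** One-sided because [duality] multiplies the mass by a positive number and bounds the product from
    above. *)
Lemma kern_mass_liminf a : -1 < a -> exists2 l : R^nat, l @ \oo --> 2 * pi &
  forall n, ((l n)%:E <= \int[mu]_(t in `[0%R, (2 * pi)%R]) (kern a (1 - eps n) (cos (t - 0)))%:E)%E.
Proof.
move=> a1; have c0 := c_alpha_gt0 _ a1; have pi0 := pi_gt0 R.
pose I n := (\int[mu]_(u in `[0%R, n%:R]) ((1 + u ^+ 2) `^ (- (1 + a / 2)))%:E)%E.
have T0 : 0 < 2 * c_alpha a * 2 `^ (a + 1).
  exact: (mulr_gt0 (mulr_gt0 (ltr0n _ 2) c0) (powR_gt0 _ (ltr0n _ 2))).
have [J JE] : exists J, cauchy_mass (1 + a / 2) = J%:E :> \bar R.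
  have := cauchy_mass_kernel _ a1; have := @cauchy_mass_ge0 R (1 + a / 2).
  by case: cauchy_mass => [J _ _|_|//]; [exists J|rewrite gt0_muley// lte_fin].
have KJ := cauchy_mass_kernel _ a1; rewrite JE -EFinM in KJ; case: KJ => KJ.
have mf : measurable_fun setT (fun u : R => (1 + u ^+ 2) `^ (- (1 + a / 2))) by meas.
have IJ : I n @[n --> \oo] --> J%:E.
  rewrite -JE; by apply: ge0_cvgn_integral; [move=> u; exact: powR_ge0|exact: mf].
have Ifin n : I n \is a fin_num.
  rewrite ge0_fin_numE; last by apply: integral_ge0 => u _; rewrite lee_fin powR_ge0.
  apply: (@le_lt_trans _ _ (cauchy_mass (1 + a / 2))); last by rewrite JE ltry.
  apply: ge0_subset_integral => //.
  - exact/measurable_funTS/measurable_EFinP.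
  - by move=> u _; rewrite lee_fin powR_ge0.
  - by move=> u /=; rewrite !in_itv/= => /andP[-> _].
exists (fun n => 2 * c_alpha a * (2 - eps n) `^ (a + 1) * fine (I n)); last first.
  by move=> n; rewrite EFinM fineK//; exact: kern_mass_ge.
rewrite -KJ; apply: cvgM; last by move/fine_cvgP : IJ => [].
apply: cvgMr.
have e2 : 2 - eps n @[n --> \oo] --> (2 : R).
  by rewrite -[X in _ --> X]subr0; apply: cvgB; [exact: cvg_cst|exact: cvg_eps].
have c2 : {for 2, continuous (fun x : R => x `^ (a + 1))} by exact: powR_continuous.
exact: (cvg_comp _ _ e2 c2).
Qed.

(** Kernel average of the chord length: for a test function that is Lipschitz in the chord it
    controls the error of replacing its value at s by its value at t. *)
Definition kern_err a n : \bar R := (\int[mu]_(t in `[0%R, (2 * pi)%R])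
  (kern a (1 - eps n) (cos (t - 0)) * Num.sqrt (2 - 2 * cos (t - 0)))%:E)%E.

(** The dominating constant for [kern_err]. The chord is at most twice the root of the denominator
    D, and the remaining D^(-(a+1)/2) <= e^(-(a+1)) cancels the e^(a+1) of the numerator. *)
Lemma kern_chord_le a n y : -1 < a -> -1 <= y <= 1 ->
  kern a (1 - eps n) y * Num.sqrt (2 - 2 * y) <= 2 * c_alpha a * 2 `^ (a + 1).
Proof.
move=> a1 /andP[y0 y1]; have e0 := eps_gt0 n; have e1 := eps_le1 n.
have c0 := c_alpha_gt0 _ a1.
set e := eps n in e0 e1 *; set p := 1 + a / 2; rewrite /kern -/p.
set D := 1 + _ - _.
have De : e ^+ 2 <= D.
  by rewrite (_ : e ^+ 2 = (1 - (1 - e)) ^+ 2); [apply: kern_den_ge; lra|ring].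
have D0 : 0 < D by apply: lt_le_trans De; rewrite exprn_gt0.
have Dw : (2 - 2 * y) / 4 <= D by apply: kern_den_ge_chord; apply/andP; split; lra.
have sw : Num.sqrt (2 - 2 * y) <= 2 * D `^ (2^-1).
  rewrite powR12_sqrt ?(ltW D0)//.
  have s4 : Num.sqrt 4 = 2 :> R.
    by rewrite (_ : 4 = 2 ^+ 2) ?sqrtr_sqr ?ger0_norm// expr2 -natrM.
  rewrite -[X in _ <= X * _]s4 -sqrtrM// ler_wsqrtr//.
  by move: Dw; rewrite ler_pdivrMr// (mulrC D).
have k1 : (1 - (1 - e) ^+ 2) `^ (a + 1) = e `^ (a + 1) * (2 - e) `^ (a + 1).
  by rewrite -powRM ?(ltW e0)//; [congr (_ `^ _); ring|lra].
rewrite k1.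
apply: (@le_trans _ _ (c_alpha a * (e `^ (a + 1) * (2 - e) `^ (a + 1)) * D `^ (- p) * (2 * D `^ (2^-1)))).
  rewrite ler_wpM2l//.
  exact: (mulr_ge0 (mulr_ge0 (ltW c0) (mulr_ge0 (powR_ge0 _ _) (powR_ge0 _ _))) (powR_ge0 _ _)).
have k2 : D `^ (- p) * D `^ (2^-1) <= e `^ (- (a + 1)).
  rewrite -powRD ?(gt_eqF D0) ?implybT// (_ : - p + 2^-1 = - ((a + 1) / 2)); last by rewrite /p; field.
  apply: le_trans (powR_den_le _ _ _ _ _ De) _; [lra|by rewrite exprn_gt0|].
  by rewrite -(powR_mulrn 2 (ltW e0)) -powRrM (_ : 2%:R * _ = - (a + 1))//; field.
have k3 : (2 - e) `^ (a + 1) <= 2 `^ (a + 1).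
  by apply: ge0_ler_powR; rewrite ?nnegrE; lra.
have k4 : e `^ (a + 1) * (D `^ (- p) * D `^ (2^-1)) <= 1.
  apply: le_trans (ler_wpM2l (powR_ge0 _ _) k2) _.
  by rewrite -powRD ?(gt_eqF e0) ?implybT// addrN powRr0.
have P0 := powR_ge0 (2 - e) (a + 1).
set P := (2 - e) `^ _ in k3 P0 *; set A := e `^ _ in k4 *; set B := D `^ _ in k4 *; set Q := D `^ _ in k4 *.
have -> : c_alpha a * (A * P) * B * (2 * Q) = 2 * c_alpha a * (P * (A * (B * Q))) by ring.
apply: ler_wpM2l; first by rewrite pmulr_rge0// ltW.
apply: le_trans k3; rewrite -[leRHS]mulr1; exact: ler_wpM2l.
Qed.

(** Dominated convergence: away from the centre the chord bounds the denominator below, so the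
    kernel is O(e^(a+1)) there. *)
Lemma kern_err_cvg0 a : -1 < a -> kern_err a n @[n --> \oo] --> 0%:E.
Proof.
move=> a1; have c0 := c_alpha_gt0 _ a1; have pi0 := pi_gt0 R.
pose f n t := (kern a (1 - eps n) (cos (t - 0)) * Num.sqrt (2 - 2 * cos (t - 0)))%:E.
have mf n : measurable_fun setT (f n).
  apply: (@measurableT_comp _ _ _ _ _ _ (fun y : R => (kern a (1 - eps n) y * Num.sqrt (2 - 2 * y))%:E) _ (fun t : R => cos (t - 0))).
    apply/measurable_EFinP/measurable_funM; first exact: measurable_kern.
    apply: (@measurableT_comp _ _ _ _ _ _ (@Num.sqrt R)); last by meas.
    by apply: continuous_measurable_fun; exact: sqrt_continuous.
  by apply: (@measurableT_comp _ _ _ _ _ _ (@cos R)); [exact: measurable_cos|meas].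
have cosb (t : R) : -1 <= cos t <= 1 by rewrite cos_geN1 cos_le1.
have [] := @dominated_convergence _ _ _ mu `[0%R, (2 * pi)%R]%classic (measurable_itv _) f (cst 0)
  (cst (2 * c_alpha a * 2 `^ (a + 1))%:E).
- by move=> n; apply: measurable_funTS; exact: mf.
- exact: measurable_cst.
- apply: aeW => t _; rewrite /f; set y := cos _; have /andP[y0 y1] : -1 <= y <= 1 by exact: cosb.
  apply/fine_cvgP; split; first exact: nearW.
  rewrite (_ : _ \o _ = fun n => kern a (1 - eps n) y * Num.sqrt (2 - 2 * y))//.
  (* Only y = 1 falls here: the kernel blows up, but the chord factor is exactly 0. *)
  have [w0|w0] := leP (2 - 2 * y) 0.
    by under eq_fun do rewrite (ler0_sqrtr w0) mulr0; exact: cvg_cst.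
  rewrite -(mul0r (Num.sqrt (2 - 2 * y))); apply: cvgMl.
  pose C := c_alpha a * 2 `^ (a + 1) * ((2 - 2 * y) / 4) `^ (- (1 + a / 2)).
  apply: (@squeeze_cvgr _ _ _ _ (cst 0) (fun n => C * n.+1%:R `^ (- (a + 1)))).
  + apply: nearW => n; rewrite kern_ge0//=; have e0 := eps_gt0 n; have e1 := eps_le1 n.
    set e := eps n in e0 e1 *.
    rewrite (_ : n.+1%:R `^ (- (a + 1)) = e `^ (a + 1)); last first.
      by rewrite /e -(powR_inv1 (ler0n _ _)) -powRrM mulN1r.
    have k1 : (1 - (1 - e) ^+ 2) `^ (a + 1) = e `^ (a + 1) * (2 - e) `^ (a + 1).
      by rewrite -powRM ?(ltW e0)//; [congr (_ `^ _); ring|lra].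
    rewrite /kern k1 /C.
    have k3 : (2 - e) `^ (a + 1) <= 2 `^ (a + 1).
      by apply: ge0_ler_powR; rewrite ?nnegrE; lra.
    have k2 : (1 + (1 - e) ^+ 2 - 2 * (1 - e) * y) `^ (- (1 + a / 2)) <= ((2 - 2 * y) / 4) `^ (- (1 + a / 2)).
      apply: powR_den_le; [lra|lra|].
      by apply: kern_den_ge_chord; apply/andP; split; lra.
    have P0 := powR_ge0 e (a + 1).
    set A := e `^ _ in P0 *.
    have := ler_pM (powR_ge0 _ _) (powR_ge0 _ _) k3 k2.
    set U := _ `^ _; set V := _ `^ _; set W := _ `^ _; set Z := _ `^ _ => h.
    have -> : c_alpha a * (A * U) * V = (c_alpha a * A) * (U * V) by ring.
    have -> : c_alpha a * W * Z * A = (c_alpha a * A) * (W * Z) by ring.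
    by apply: ler_wpM2l => //; exact: (mulr_ge0 (ltW c0) P0).
  + exact: cvg_cst.
  + rewrite -(mulr0 C); apply: cvgMr.
    have p0 : 0 < a + 1 by lra.
    apply: (cvg_comp _ _ _ (powRN_cvg0 _ p0)).
    apply/cvgryPge => x; apply: filterS (nbhs_infty_ger x) => n xn.
    by apply: le_trans xn _; rewrite ler_nat.
- apply/integrableP; split; first exact: measurable_cst.
  rewrite integral_cst//= lebesgue_measure_itv/= lte_fin mulr_gt0// -EFinB -EFinM ltry//.
- apply: aeW => t n _; rewrite /f/= lee_fin ger0_norm; first exact: kern_chord_le.
  by rewrite mulr_ge0 ?sqrtr_ge0// kern_ge0.
by move=> _ _; rewrite integral_cst// mul0e.
Qed.

End BoundaryLimit.

(** * Fubini for bounded signed functions on a rectangle *)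

Section BoundedFubini.
Context {R : realType}.
Local Notation mu := (@lebesgue_measure R).

Lemma integrable_scale (A : set R) (k : R) (f : R -> R) : measurable A ->
  mu.-integrable A (EFin \o f) -> mu.-integrable A (EFin \o (fun x => k * f x)).
Proof. by move=> mA i; exact: (@integrableZl _ _ _ mu A mA k (EFin \o f)). Qed.

Lemma integrable_diff (A : set R) (f g : R -> R) : measurable A ->
  mu.-integrable A (EFin \o f) -> mu.-integrable A (EFin \o g) ->
  mu.-integrable A (EFin \o (fun x => f x - g x)).
Proof. by move=> mA i j; exact: (@integrableB _ _ _ mu A mA (EFin \o f) (EFin \o g)). Qed.

(** The function cut off to the rectangle is dominated by |C| times a product of indicators, hence
    integrable on the plane. *)
Lemma bounded_Fubini (a b c d C : R) (f : R * R -> R) : measurable_fun setT f ->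
  (forall x y, a <= x <= b -> c <= y <= d -> `|f (x, y)| <= C) ->
  mu.-integrable `[a, b] (EFin \o (fun x => \int[mu]_(y in `[c, d]) f (x, y))) /\
      \int[mu]_(x in `[a, b]) \int[mu]_(y in `[c, d]) f (x, y) =
      \int[mu]_(y in `[c, d]) \int[mu]_(x in `[a, b]) f (x, y).
Proof.
move=> mf fC.
have slice1 x : measurable_fun setT (fun y => f (x, y)) by exact: (@measurableT_comp _ _ _ _ _ _ f).
have slice2 y : measurable_fun setT (fun x => f (x, y)) by exact: (@measurableT_comp _ _ _ _ _ _ f).
pose A : set R := `[a, b]%classic; pose B : set R := `[c, d]%classic.
have mA : measurable A by exact: measurable_itv.
have mB : measurable B by exact: measurable_itv.
pose g (z : R * R) := \1_A z.1 * (\1_B z.2 * f z).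
have mg : measurable_fun setT g.
  apply/measurable_funM.
    by apply: (@measurableT_comp _ _ _ _ _ _ (\1_A : R -> R)).
  apply: measurable_funM => //.
  by apply: (@measurableT_comp _ _ _ _ _ _ (\1_B : R -> R)).
have ig1 x : A x -> mu.-integrable B (EFin \o (fun y => f (x, y))).
  by rewrite /A /= in_itv/= => xA; apply: (@bounded_integrable _ _ _ _ C) => // y; exact: fC.
have ig2 y : B y -> mu.-integrable A (EFin \o (fun x => f (x, y))).
  by rewrite /B /= in_itv/= => yB; apply: (@bounded_integrable _ _ _ _ C) => // x xA; exact: fC.
have gC z : `|g z| <= `|C| * (\1_A z.1 * \1_B z.2).
  case: z => x y; rewrite /g/= !indicE.
  case: (boolP (x \in A)) => xA; last by rewrite !mul0r normr0 mulr0.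
  case: (boolP (y \in B)) => yB; last by rewrite !mul0r !mulr0 normr0.
  rewrite !mul1r mulr1; apply: le_trans (ler_norm _).
  have {}xA : a <= x <= b by move/set_mem: xA; rewrite /A/= in_itv.
  have {}yB : c <= y <= d by move/set_mem: yB; rewrite /B/= in_itv.
  exact: fC.
have ig : (mu \x mu)%E.-integrable setT (EFin \o g).
  apply/integrable12ltyP; first exact/measurable_EFinP.
  have iI (D : set R) : measurable D -> (\int[mu]_x (\1_D x)%:E = mu D)%E.
    by move=> mD; rewrite integral_indic// setIT.
  have muf (u v : R) : (mu `[u, v]%classic < +oo)%E.
    rewrite lebesgue_measure_itv/= lte_fin; by case: ifP => _; rewrite -?EFinB ltry.
  apply: (@le_lt_trans _ _ (\int[mu]_x (`|C|%:E * (\1_A x)%:E * mu B))%E).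
    apply: ge0_le_integral => //.
    - by move=> x _; apply: integral_ge0 => y _.
    - apply: (measurable_fun_fubini_tonelli_F (m2 := mu) (fun z => `|(EFin \o g) z|%E)) => //.
      by apply: measurableT_comp => //; exact/measurable_EFinP.
    - apply: emeasurable_funM => //; apply: emeasurable_funM => //.
      by apply/measurable_EFinP; exact: measurable_indic.
    - move=> x _; rewrite -iI// -ge0_integralZl//; last first.
        by apply/measurable_EFinP; exact: measurable_indic.
      apply: ge0_le_integral => //.
      + apply: measurableT_comp => //; apply/measurable_EFinP.
        by apply: (@measurableT_comp _ _ _ _ _ _ g).
      + by apply: emeasurable_funM => //; apply/measurable_EFinP; exact: measurable_indic.
      + by move=> y _; rewrite /= -!EFinM lee_fin -mulrA; exact: gC.
  have mI (D : set R) : measurable D -> measurable_fun setT (fun x : R => (\1_D x)%:E).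
    by move=> mD; apply/measurable_EFinP; exact: measurable_indic.
  rewrite ge0_integralZr; [|exact: measurableT| | |exact: measure_ge0]; last 2 first.
  - by apply: emeasurable_funM => //; exact: mI.
  - by move=> x _; rewrite mule_ge0// lee_fin.
  rewrite ge0_integralZl; [|exact: measurableT|exact: mI|by move=> x _; rewrite lee_fin|by rewrite lee_fin].
  have fA : mu A \is a fin_num by rewrite ge0_fin_numE; [exact: muf|exact: measure_ge0].
  have fB : mu B \is a fin_num by rewrite ge0_fin_numE; [exact: muf|exact: measure_ge0].
  by rewrite iI// -(fineK fA) -(fineK fB) -!EFinM ltry.
have L (x : R) : (\int[mu]_y (EFin \o g) (x, y))%E = ((fun x => (\int[mu]_(y in B) f (x, y))%:E) \_ A)%E x.
  rewrite patchE; case: ifPn => xA; last first.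
    by rewrite integral0_eq// => y _; rewrite /= /g/= [X in X * _]indicE (negbTE xA) mul0r.
  rewrite /Rintegral fineK; last by apply: integrable_fin_num => //; apply: ig1; exact: set_mem.
  rewrite [RHS]integral_mkcond; apply: eq_integral => y _; rewrite patchE /g/= [X in X * _]indicE xA mul1r indicE.
  by case: ifP; rewrite ?mul1r ?mul0r.
have L' (y : R) : (\int[mu]_x (EFin \o g) (x, y))%E = ((fun y => (\int[mu]_(x in A) f (x, y))%:E) \_ B)%E y.
  rewrite patchE; case: ifPn => yB; last first.
    by rewrite integral0_eq// => x _; rewrite /= /g/= [X in _ * (X * _)]indicE (negbTE yB) mul0r mulr0.
  rewrite /Rintegral fineK; last by apply: integrable_fin_num => //; apply: ig2; exact: set_mem.
  rewrite [RHS]integral_mkcond; apply: eq_integral => x _; rewrite patchE /g/= [X in _ * (X * _)]indicE yB mul1r indicE.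
  by case: ifP; rewrite ?mul1r ?mul0r.
have iF := integrable_fubini_F ig.
split.
- apply: (proj2 (@integrable_mkcond _ _ _ mu A _ mA)); move: iF; congr (_ .-integrable _ _).
  by apply/funext => x; rewrite /fubini_F L.
have := Fubini ig.
under eq_integral do rewrite L.
under [X in _ = X -> _]eq_integral do rewrite L'.
rewrite -!integral_mkcond => h.
by rewrite /Rintegral -/A -/B; congr fine; exact: h.
Qed.

End BoundedFubini.

(** * Pairing the boundary function with the centred kernel *)

Section Duality.
Context {R : realType}.
Local Notation mu := (@lebesgue_measure R).
Local Notation D := (`[0%R, (2 * pi)%R]%classic : set R).
Implicit Types (a r s t : R).

Lemma measurable_kern_cos a r s : measurable_fun setT (fun t : R => kern a r (cos (t - s))).
Proof.
apply: (@measurableT_comp _ _ _ _ _ _ (kern a r) _ (fun t : R => cos (t - s))).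
  exact: measurable_kern.
by apply: (@measurableT_comp _ _ _ _ _ _ (@cos R)); [exact: measurable_cos|meas].
Qed.

Lemma norm_kern_le a r y : -1 < a -> 0 <= r < 1 -> y <= 1 -> `|kern a r y| <= kern_max a r.
Proof. by move=> a1 r1 y1; rewrite ger0_norm ?kern_ge0// kern_le_max. Qed.

Lemma Palpha_polar a (h : R -> R) r s : 0 <= r ->
  Palpha a h (r * cos s, r * sin s) = (2 * pi)^-1 * \int[mu]_(t in D) (kern a r (cos (t - s)) * h t).
Proof.
move=> r0; rewrite /Palpha; congr (_ * _); rewrite /Rintegral; congr fine.
by apply: eq_integral => t _; rewrite KalphaE.
Qed.

(** The kernel increases with y, so after folding onto [0, pi/2] the absolute values open with
    opposite signs at cos t and - cos t. The constant kappa cancels, leaving the integral of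
    [bound_rhs_integral]. *)
Lemma kern_deviation_integral a r s : -1 < a -> 0 <= r < 1 -> 0 <= s <= 2 * pi ->
  \int[mu]_(t in D) `|kern a r (cos (t - s)) - kern a r 0| = 2 * pi * bound_rhs a r.
Proof.
move=> a1 r01 s2; have /andP[r0 r1] := r01; have pi0 := pi_gt0 R.
pose Phi (y : R) : R := `|kern a r y - kern a r 0|.
have mk := @measurable_kern R a r.
have mPhi : measurable_fun setT Phi.
  by apply: measurableT_comp => //; exact: measurable_funB.
have Phi0 y : 0 <= Phi y by rewrite /Phi.
have mPhiN : measurable_fun setT (fun y : R => Phi (- y)).
  by apply: (@measurableT_comp _ _ _ _ _ _ Phi); [exact: mPhi|exact: measurable_funN].
apply: EFin_inj.
pose K := c_alpha a * (1 - r ^+ 2) `^ (a + 1).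
have K0 : 0 <= K by exact: (mulr_ge0 (ltW (c_alpha_gt0 _ a1)) (powR_ge0 _ _)).
rewrite [RHS]EFinM bound_rhs_integral// -/K muleA -EFinM.
have -> : 2 * pi * (K / pi) = 2 * K by move: (pi : R) pi0 => p p0; field; rewrite gt_eqF.
have mcosE (F : R -> R) : measurable_fun setT F -> measurable_fun D (fun t : R => (F (cos t))%:E).
  by move=> mF; apply: measurable_funTS; exact: measurable_fun_comp_cos.
pose I := (\int[mu]_(t in D) (Phi (cos (t - s)))%:E)%E.
have IE : I = ((2 * K)%:E * \int[mu]_(t in `[0%R, (pi / 2)%R])
      ((1 + r ^+ 2 - 2 * r * cos t) `^ (- (1 + a / 2)) -
       (1 + r ^+ 2 + 2 * r * cos t) `^ (- (1 + a / 2)))%:E)%E.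
  rewrite /I (integral_circle_cos _ _ mPhi Phi0 s2) (integral_0pi_cos _ mPhi Phi0).
  rewrite -ge0_integralD; [|exact: measurable_itv|by move=> t _; rewrite lee_fin
    |by apply: measurable_funTS; exact: (measurable_fun_comp_cos mPhi)
    |by move=> t _; rewrite lee_fin
    |by apply: measurable_funTS; exact: (measurable_fun_comp_cos mPhiN)].
  have den (c : R) : 0 <= c -> c <= 1 -> [/\ 0 < 1 + r ^+ 2 - 2 * r * c,
      1 + r ^+ 2 - 2 * r * c <= 1 + r ^+ 2 & 1 + r ^+ 2 <= 1 + r ^+ 2 + 2 * r * c].
    move=> c0 c1; have rc : 0 <= r * c by exact: mulr_ge0.
    split; [|lra|lra]; apply: lt_le_trans (@kern_den_ge R r c r0 c1).
    by rewrite exprn_gt0// subr_gt0.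
  have mono (c : R) : 0 <= c -> c <= 1 ->
      (1 + r ^+ 2) `^ (- (1 + a / 2)) <= (1 + r ^+ 2 - 2 * r * c) `^ (- (1 + a / 2)) /\
      (1 + r ^+ 2 + 2 * r * c) `^ (- (1 + a / 2)) <= (1 + r ^+ 2) `^ (- (1 + a / 2)).
    move=> c0 c1; have [d1 d2 d3] := den c c0 c1.
    split; apply: powR_den_le; lra.
  rewrite EFinM -muleA; congr (_ * _)%E.
  rewrite -ge0_integralZl; [|exact: measurable_itv| | |by rewrite lee_fin]; last 2 first.
  - by apply/measurable_funTS/measurable_EFinP; have mc := @measurable_cos R; meas.
  - move=> t; rewrite /= in_itv/= => /cos_ge0_quadrant c0.
    have [m1 m2] := mono _ c0 (cos_le1 t).
    by rewrite lee_fin subr_ge0 (le_trans m2).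
  apply: eq_integral => t; rewrite inE/= in_itv/= => /cos_ge0_quadrant c0.
  have [m1 m2] := mono _ c0 (cos_le1 t).
  rewrite -EFinD -EFinM; congr EFin.
  have eK x y : `|K * x - K * y| = K * `|x - y| by rewrite -mulrBr normrM (ger0_norm K0).
  rewrite /Phi /kern -/K mulr0 subr0 mulrN opprK !eK -mulrDr.
  congr (_ * _); rewrite ger0_norm ?subr_ge0// ler0_norm ?subr_le0//.
  by ring.
rewrite -IE /Rintegral fineK//.
apply: integrable_fin_num => //.
apply: (@bounded_integrable _ _ _ _ (kern_max a r + kern_max a r)).
  apply: measurableT_comp => //; apply: measurable_funB => //; exact: measurable_kern_cos.
by move=> t _; rewrite normr_id (le_trans (ler_normB _ _))// lerD// norm_kern_le// cos_le1.
Qed.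

(** The conclusion does not contain [C]: the crude bound on h only multiplies an error that tends to
    0, while the leading term uses the bound 1 on the Poisson integral inside the disk. *)
Lemma duality a (h : R -> R) C r s : -1 < a -> 0 <= r < 1 -> 0 <= s <= 2 * pi ->
  measurable_fun setT h -> (forall t, `|h t| <= C) ->
  (forall r' s', 0 <= r' < 1 -> 0 <= s' <= 2 * pi -> `|Palpha a h (r' * cos s', r' * sin s')| <= 1) ->
  \int[mu]_(t in D) ((kern a r (cos (t - s)) - kern a r 0) * h t) <=
  \int[mu]_(t in D) `|kern a r (cos (t - s)) - kern a r 0|.
Proof.
move=> a1 r01 s2 mh hC P1; have /andP[r0 r1] := r01; have pi0 := pi_gt0 R.
pose phi t := kern a r (cos (t - s)) - kern a r 0.
pose X' := \int[mu]_(t in D) (phi t * h t).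
pose Y' := \int[mu]_(t in D) `|phi t|.
suff : X' <= Y' by [].
have mphi : measurable_fun setT phi by apply: measurable_funB => //; exact: measurable_kern_cos.
pose B := kern_max a r + kern_max a r.
have phiB t : `|phi t| <= B.
  by rewrite (le_trans (ler_normB _ _))// lerD// norm_kern_le// cos_le1.
have [L L0 lip] := kern_lipschitz _ _ a1 r01.
have philip s' t : `|phi s' - phi t| <= L * Num.sqrt (2 - 2 * cos (s' - t)).
  have -> : phi s' - phi t = kern a r (cos (s' - s)) - kern a r (cos (t - s)) by rewrite /phi; ring.
  by apply: le_trans (lip _ _ (cos_le1 _) (cos_le1 _)) _; apply: ler_wpM2l => //; exact: cos_dist_le_chord.
have mD : measurable D by exact: measurable_itv.
have B0 : 0 <= B by apply: le_trans (phiB 0).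
have C0 : 0 <= C by apply: le_trans (hC 0).
have main n (e := fine (kern_err a n)) (M := fine (\int[mu]_(t in D) (kern a (1 - n.+1%:R^-1) (cos (t - 0)))%:E)%E) :
    M * X' <= 2 * pi * Y' + 2 * pi * (C * (L * e)).
  set q : R := 1 - n.+1%:R^-1; have e0 := @eps_gt0 R n; have e1 := @eps_le1 R n.
  have q01 : 0 <= q < 1.
    by move: e0 e1; rewrite /q; set x := n.+1%:R^-1 => e0 e1; apply/andP; split; lra.
  have /andP[q0 q1] := q01.
  have kq y : y <= 1 -> `|kern a q y| <= kern_max a q by exact: norm_kern_le.
  have kq0 : 0 <= kern_max a q by apply: le_trans (kq 0 _).
  (* s' is the angle of an interior point of radius q and t the boundary angle; the two orders of
     integration are compared. *)
  pose F (z : R * R) := phi z.1 * (kern a q (cos (z.2 - z.1)) * h z.2).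
  have mF : measurable_fun setT F.
    apply: measurable_funM; first exact: (@measurableT_comp _ _ _ _ _ _ phi).
    apply: measurable_funM; last exact: (@measurableT_comp _ _ _ _ _ _ h).
    apply: (@measurableT_comp _ _ _ _ _ _ (kern a q)); first exact: measurable_kern.
    by apply: (@measurableT_comp _ _ _ _ _ _ (@cos R)); [exact: measurable_cos|meas].
  have FB z : `|F z| <= B * (kern_max a q * C).
    rewrite /F normrM normrM; apply: ler_pM => //.
    by apply: ler_pM => //; apply: kq; exact: cos_le1.
  have [i1 fub] := @bounded_Fubini R 0 (2 * pi) 0 (2 * pi) _ F mF (fun x y _ _ => FB (x, y)).
  have mF' : measurable_fun setT (fun z : R * R => F (z.2, z.1)).
    by apply: (@measurableT_comp _ _ _ _ _ _ F) => //; apply: measurable_fun_pair.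
  (* Used with swapped coordinates only for the integrability in t of the inner integral, called [G]
     below. *)
  have [i2 _] := @bounded_Fubini R 0 (2 * pi) 0 (2 * pi) _ _ mF' (fun x y _ _ => FB (y, x)).
  have ikh s' : mu.-integrable D (EFin \o (fun t => kern a q (cos (t - s')) * h t)).
    apply: (@bounded_integrable _ _ _ _ (kern_max a q * C)).
      by apply: measurable_funM => //; exact: measurable_kern_cos.
    by move=> t _; rewrite normrM ler_pM// kq// cos_le1.
  have iphi : mu.-integrable D (EFin \o phi) by exact: (@bounded_integrable _ _ _ _ B).
  have iaphi : mu.-integrable D (EFin \o (fun t => `|phi t|)) by exact: integrable_norm.
  (* Integrating over t first gives 2 pi times phi(s') times a value of the Poisson integral, whose
     modulus is at most 1. *)
  have U1 : \int[mu]_(s' in D) \int[mu]_(t in D) F (s', t) <= 2 * pi * Y'.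
    rewrite /Y' -RintegralZl//.
    apply: le_Rintegral => //.
      exact: (integrable_scale _ (2 * pi) _ mD iaphi).
    move=> s'; rewrite /= in_itv/= => s'2.
    rewrite /F/= RintegralZl//.
    have := P1 q s' q01 s'2; rewrite Palpha_polar// normrM ger0_norm ?invr_ge0 ?mulr_ge0 ?(ltW pi0)//.
    rewrite ler_pdivrMl ?mulr_gt0// mulr1 => U.
    apply: le_trans (ler_norm _) _; rewrite normrM mulrC.
    by apply: ler_wpM2r.
  have MC t : 0 <= t <= 2 * pi -> \int[mu]_(s' in D) kern a q (cos (s' - t)) = M.
    move=> t2; rewrite /M /Rintegral; congr fine.
    have mk := @measurable_kern R a q.
    rewrite (@integral_circle_cos _ (kern a q) t mk _ t2); last by move=> y; exact: kern_ge0.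
    rewrite (@integral_circle_cos _ (kern a q) 0 mk)// ?lexx ?mulr_ge0 ?(ltW pi0)// => y.
    exact: kern_ge0.
  have ik t : mu.-integrable D (EFin \o (fun s' => kern a q (cos (s' - t)))).
    apply: (@bounded_integrable _ _ _ _ (kern_max a q)); first exact: measurable_kern_cos.
    by move=> s' _; rewrite kq// cos_le1.
  pose ch y := kern a q y * Num.sqrt (2 - 2 * y).
  have mch : measurable_fun setT ch.
    apply: measurable_funM; first exact: measurable_kern.
    apply: (@measurableT_comp _ _ _ _ _ _ (@Num.sqrt R)); last by meas.
    by apply: continuous_measurable_fun; exact: sqrt_continuous.
  have ch0 y : 0 <= ch y by rewrite /ch mulr_ge0 ?sqrtr_ge0 ?kern_ge0.
  have eC t : 0 <= t <= 2 * pi -> \int[mu]_(s' in D) ch (cos (s' - t)) = e.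
    move=> t2; rewrite /e /kern_err /Rintegral; congr fine.
    rewrite (@integral_circle_cos _ ch t mch ch0 t2).
    by rewrite -(@integral_circle_cos _ ch 0 mch ch0)// lexx mulr_ge0// ltW.
  have ich t : mu.-integrable D (EFin \o (fun s' => ch (cos (s' - t)))).
    apply: (@bounded_integrable _ _ _ _ (2 * c_alpha a * 2 `^ (a + 1))).
      apply: (@measurableT_comp _ _ _ _ _ _ ch) => //.
      by apply: (@measurableT_comp _ _ _ _ _ _ (@cos R)); [exact: measurable_cos|meas].
    by move=> s' _; rewrite ger0_norm// kern_chord_le// cos_geN1 cos_le1.
  pose G t := \int[mu]_(s' in D) F (s', t).
  (* Integrating over s' first averages phi around t with total mass [M]; the Lipschitz bound turns
     the deviation into the averaged chord [e]. *)
  have GE t : 0 <= t <= 2 * pi -> `|M * (phi t * h t) - G t| <= C * (L * e).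
    move=> t2.
    have GF : G t = h t * \int[mu]_(s' in D) (phi s' * kern a q (cos (s' - t))).
      rewrite /G -RintegralZl//; last first.
        apply: (@bounded_integrable _ _ _ _ (B * kern_max a q)).
          by apply: measurable_funM => //; exact: measurable_kern_cos.
        by move=> s' _; rewrite normrM ler_pM// kq// cos_le1.
      apply: eq_Rintegral => s' _; rewrite /F/= -(cosN (t - s')) opprB; ring.
    have ipk : mu.-integrable D (EFin \o (fun s' => phi s' * kern a q (cos (s' - t)))).
      apply: (@bounded_integrable _ _ _ _ (B * kern_max a q)).
        by apply: measurable_funM => //; exact: measurable_kern_cos.
      by move=> s' _; rewrite normrM ler_pM// kq// cos_le1.
    have itk : mu.-integrable D (EFin \o (fun s' => phi t * kern a q (cos (s' - t)))).
      by exact: (integrable_scale _ (phi t) _ mD (ik t)).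
    have -> : M * (phi t * h t) - G t = h t * (phi t * M - \int[mu]_(s' in D) (phi s' * kern a q (cos (s' - t)))).
      by rewrite GF; ring.
    rewrite -(MC t t2) -RintegralZl// -RintegralB// normrM; apply: ler_pM => //.
    have T1 := @le_normr_Rintegral _ _ _ mu D _ mD (integrable_diff _ _ _ mD itk ipk).
    apply: le_trans T1 _.
    rewrite -(eC t t2) -RintegralZl//; apply: le_Rintegral => //.
    - by apply: integrable_norm; exact: (integrable_diff _ _ _ mD itk ipk).
    - by exact: (integrable_scale _ L _ mD (ich t)).
    move=> s' _; rewrite -mulrBl normrM (@ger0_norm _ (kern _ _ _)) ?kern_ge0//.
    have -> : L * ch (cos (s' - t)) = L * Num.sqrt (2 - 2 * cos (s' - t)) * kern a q (cos (s' - t)).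
      by rewrite /ch; ring.
    by apply: ler_wpM2r; [exact: kern_ge0|rewrite distrC; exact: philip].
  have iX : mu.-integrable D (EFin \o (fun t => M * (phi t * h t))).
    have ip : mu.-integrable D (EFin \o (fun t => phi t * h t)).
      apply: (@bounded_integrable _ _ _ _ (B * C)); first exact: measurable_funM.
      by move=> t _; rewrite normrM ler_pM.
    by exact: (integrable_scale _ M _ mD ip).
  have ip : mu.-integrable D (EFin \o (fun t => phi t * h t)).
    apply: (@bounded_integrable _ _ _ _ (B * C)); first exact: measurable_funM.
    by move=> t _; rewrite normrM ler_pM.
  have dX : M * X' - \int[mu]_(t in D) G t <= 2 * pi * (C * (L * e)).
    rewrite /X' -RintegralZl// -RintegralB//.
    apply: le_trans (ler_norm _) _.
    have T1 := @le_normr_Rintegral _ _ _ mu D _ mD (integrable_diff _ _ _ mD iX i2).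
    apply: le_trans T1 _.
    apply: (@le_trans _ _ (\int[mu]_(t in D) (C * (L * e)))).
      apply: le_Rintegral => //.
      - by apply: integrable_norm; exact: (integrable_diff _ _ _ mD iX i2).
      - by apply: (@bounded_integrable _ _ _ _ `|C * (L * e)|).
    rewrite Rintegral_cst//= lebesgue_measure_itv/= lte_fin mulr_gt0//= oppr0 addr0.
    by rewrite mulrC.
  rewrite -lerBlDr; apply: le_trans U1; rewrite lerBlDr addrC -lerBlDr fub.
  exact: dX.
have e_cvg : fine (kern_err a n) @[n --> \oo] --> (0 : R).
  by have /fine_cvgP[] := kern_err_cvg0 _ a1.
have [l lcvg lM] := kern_mass_liminf _ a1.
(* Positivity of [X'] is what allows [M] to be replaced by its lower bound [l n]. *)
have [X0|X0] := leP X' 0; first by apply: (le_trans X0); apply: Rintegral_ge0.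
have le_n n : l n * X' <= 2 * pi * Y' + 2 * pi * (C * (L * fine (kern_err a n))).
  apply: le_trans (main n); apply: ler_wpM2r; first exact: ltW.
  rewrite -lee_fin fineK; first exact: lM.
  apply: integrable_fin_num => //.
  apply: (@bounded_integrable _ _ _ _ (kern_max a (1 - n.+1%:R^-1))); first exact: measurable_kern_cos.
  move=> t _; have e0 := @eps_gt0 R n; have e1 := @eps_le1 R n.
  rewrite norm_kern_le ?cos_le1//; move: e0 e1; set x := n.+1%:R^-1 => e0 e1.
  by apply/andP; split; lra.
have c1 : l n * X' @[n --> \oo] --> 2 * pi * X' by exact: cvgMl.
have c2 : 2 * pi * Y' + 2 * pi * (C * (L * fine (kern_err a n))) @[n --> \oo] --> 2 * pi * Y'.
  have c3 : 2 * pi * (C * (L * fine (kern_err a n))) @[n --> \oo] --> 2 * pi * (C * (L * 0)).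
    by apply: cvgMr; apply: cvgMr; apply: cvgMr; exact: e_cvg.
  rewrite !mulr0 in c3.
  by rewrite -[X in _ --> X]addr0; apply: cvgD; [exact: cvg_cst|exact: c3].
have : 2 * pi * X' <= 2 * pi * Y'.
  rewrite -(cvg_lim _ c1)// -(cvg_lim _ c2)//; apply: ler_lim.
  - by apply/cvg_ex; exists (2 * pi * X').
  - by apply/cvg_ex; exists (2 * pi * Y').
  - exact: nearW.
by rewrite ler_pM2l// mulr_gt0.
Qed.

End Duality.

(** * An everywhere bounded representative of the boundary function *)

Section Truncation.
Context {R : realType}.
Local Notation mu := (@lebesgue_measure R).
Local Notation D := (`[0%R, (2 * pi)%R]%classic : set R).

Lemma ae_imply (P Q : R -> Prop) : (forall t, P t -> Q t) ->
  {ae mu, forall t, P t} -> {ae mu, forall t, Q t}.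
Proof.
move=> PQ [N [mN N0 sN]]; exists N; split => // t /= nQ; apply: sN => /= pt.
by apply: nQ; exact: PQ.
Qed.

(** Boundary data are measurable only on [0, 2 pi] and bounded only almost everywhere. Setting them
    to 0 where they exceed C and outside the interval changes no Poisson integral, and allows
    pointwise bounds afterwards. *)
Lemma bounded_representative (g : R -> R) (C : R) : 0 <= C -> measurable_fun D g ->
  {ae mu, forall t, D t -> `|g t| <= C} ->
  exists g' : R -> R, [/\ measurable_fun setT g', forall t, `|g' t| <= C &
    forall a r s, 0 <= r ->
      Palpha a g' (r * cos s, r * sin s) = Palpha a g (r * cos s, r * sin s)].
Proof.
move=> C0 mg gC.
have mD : measurable D by exact: measurable_itv.
pose tr (x : R) : R := if `|x| <= C then x else 0.
have mtr : measurable_fun setT tr.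
  by apply: measurable_fun_ifT => //; apply: measurable_fun_ler => //; exact: measurableT_comp.
have mtg : measurable_fun D (tr \o g) by exact: measurableT_comp.
exists ((tr \o g) \_ D); split.
- by apply/(measurable_restrictT _ mD).
- move=> t; rewrite patchE; case: ifP => _; last by rewrite normr0.
  by rewrite /= /tr; case: ifP => // _; rewrite normr0.
- move=> a r s r0; rewrite !Palpha_polar//; congr (_ * _); rewrite /Rintegral; congr fine.
  have mk := @measurable_kern_cos R a r s.
  apply: ae_eq_integral => //.
  + apply/measurable_EFinP/measurable_funM; first exact: measurable_funTS.
    apply: measurable_funTS; exact/(measurable_restrictT _ mD).
  + by apply/measurable_EFinP/measurable_funM; first exact: measurable_funTS.
  + apply: ae_imply gC => t gt Dt; congr EFin; rewrite patchE mem_set// /= /tr.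
    by rewrite gt.
Qed.

End Truncation.

(** * The real Schwarz estimate and the reduction of complex values to it *)

Section SchwarzLemma.
Context {R : realType}.
Local Notation mu := (@lebesgue_measure R).
Local Notation D := (`[0%R, (2 * pi)%R]%classic : set R).

Lemma Palpha_schwarz a (h : R -> R) C r s : -1 < a -> 0 <= r < 1 -> 0 <= s <= 2 * pi ->
  measurable_fun setT h -> (forall t, `|h t| <= C) ->
  (forall r' s', 0 <= r' < 1 -> 0 <= s' <= 2 * pi -> `|Palpha a h (r' * cos s', r' * sin s')| <= 1) ->
  Palpha a h (0, 0) = 0 ->
  Palpha a h (r * cos s, r * sin s) <= bound_rhs a r.
Proof.
move=> a1 r01 s2 mh hC P1 P0; have /andP[r0 r1] := r01; have pi0 := pi_gt0 R.
have tp0 : 0 < 2 * pi :> R by rewrite mulr_gt0.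
have mD : measurable D by exact: measurable_itv.
have c0 := c_alpha_gt0 _ a1.
have ih : mu.-integrable D (EFin \o h) by apply: (@bounded_integrable _ _ _ _ C).
have h0 : \int[mu]_(t in D) h t = 0.
  (* At the centre the kernel is a nonzero constant, so the vanishing of the Poisson integral there
     says that h has mean zero; any multiple of h may then be subtracted under the integral. *)
  have k0 t : kern a 0 (cos (t - 0)) = c_alpha a.
    by rewrite /kern expr0n/= mulr0 mul0r !subr0 addr0 !powR1 !mulr1.
  have := @Palpha_polar R a h 0 0 (lexx 0); rewrite !mul0r P0.
  under eq_Rintegral do rewrite k0.
  rewrite RintegralZl// => /esym/eqP.
  by rewrite mulf_eq0 invr_eq0 (gt_eqF tp0)/= mulf_eq0 (gt_eqF c0)/= => /eqP.
have ikh : mu.-integrable D (EFin \o (fun t => kern a r (cos (t - s)) * h t)).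
  apply: (@bounded_integrable _ _ _ _ (kern_max a r * C)).
    by apply: measurable_funM => //; exact: measurable_kern_cos.
  by move=> t _; rewrite normrM ler_pM// norm_kern_le// cos_le1.
have idh : mu.-integrable D (EFin \o (fun t => kern a r 0 * h t)).
  by exact: (integrable_scale _ (kern a r 0) _ mD ih).
rewrite Palpha_polar// ler_pdivrMl// -(kern_deviation_integral _ _ _ a1 r01 s2).
apply: le_trans (duality _ _ _ _ _ a1 r01 s2 mh hC P1).
under [leRHS]eq_Rintegral do rewrite mulrBl.
by rewrite RintegralB// RintegralZl// h0 mulr0 subr0.
Qed.

Lemma polar (z : R * R) : exists2 s, 0 <= s <= 2 * pi & z = (cnorm z * cos s, cnorm z * sin s).
Proof.
case: z => x y; rewrite /cnorm/=; set r := Num.sqrt _.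
have pi0 := pi_gt0 R.
have n0 : 0 <= x ^+ 2 + y ^+ 2 by rewrite addr_ge0 ?sqr_ge0.
have rr : r ^+ 2 = x ^+ 2 + y ^+ 2 by rewrite sqr_sqrtr.
have r0 : 0 <= r by exact: sqrtr_ge0.
have [re0|rn0] := eqVneq r 0.
  exists 0; first by rewrite lexx mulr_ge0// ltW.
  move: rr; rewrite re0 expr0n/= => /esym/eqP; rewrite paddr_eq0 ?sqr_ge0// !sqrf_eq0 => /andP[/eqP-> /eqP->].
  by rewrite !mul0r.
have rp : 0 < r by rewrite lt_neqAle eq_sym rn0.
pose c := x / r.
have xr : x = r * c by rewrite mulrC divfK.
have c1 : -1 <= c <= 1.
  rewrite -ler_norml -(@ler_pXn2r _ 2) ?nnegrE// expr1n real_normK ?num_real// /c expr_div_n rr.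
  by rewrite ler_pdivrMr ?mul1r ?lerDl ?sqr_ge0// -rr exprn_gt0.
have a0 := acos_ge0 c1; have ap := acos_lepi c1.
have ca : cos (acos c) = c by apply: acosK; rewrite in_itv.
have sa := sin_acos c1.
have yr : y ^+ 2 = r ^+ 2 * (1 - c ^+ 2).
  by rewrite mulrBr mulr1 -exprMn -xr rr addrC addKr.
have sq : r * Num.sqrt (1 - c ^+ 2) = `|y|.
  rewrite -[in LHS](ger0_norm r0) -sqrtr_sqr -sqrtrM ?sqr_ge0// -yr sqrtr_sqr//.
have [y0|y0] := leP 0 y.
  exists (acos c); first by apply/andP; split => //; lra.
  by rewrite ca sa sq -xr ger0_norm.
exists (2 * pi - acos c); first by apply/andP; split; lra.
have e : 2 * pi - acos c = - acos c + pi *+ 2 by rewrite addrC mulr_natl.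
by rewrite e cosD2pi sinD2pi cosN sinN ca sa mulrN sq -xr ltr0_norm// opprK.
Qed.

Lemma cauchy_schwarz2 (u1 u2 x y : R) : u1 ^+ 2 + u2 ^+ 2 = 1 -> `|u1 * x + u2 * y| <= cnorm (x, y).
Proof.
move=> u; rewrite /cnorm/= -sqrtr_sqr ler_wsqrtr//.
have -> : x ^+ 2 + y ^+ 2 = (u1 ^+ 2 + u2 ^+ 2) * (x ^+ 2 + y ^+ 2) by rewrite u mul1r.
have -> : (u1 ^+ 2 + u2 ^+ 2) * (x ^+ 2 + y ^+ 2) = (u1 * x + u2 * y) ^+ 2 + (u1 * y - u2 * x) ^+ 2 by ring.
by rewrite lerDl sqr_ge0.
Qed.

(** The rotation taking w to its modulus, as a real linear form; at w = 0 the direction is arbitrary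
    and (1, 0) is taken. *)
Lemma unit_direction (w : R * R) : exists u1 u2 : R, u1 ^+ 2 + u2 ^+ 2 = 1 /\ u1 * w.1 + u2 * w.2 = cnorm w.
Proof.
have [w0|wn0] := eqVneq (cnorm w) 0.
  exists 1, 0; split; first by rewrite expr1n expr0n addr0.
  move: (w0); rewrite /cnorm => /eqP; rewrite sqrtr_eq0 => h.
  have : w.1 ^+ 2 + w.2 ^+ 2 = 0 by apply/eqP; rewrite eq_le h addr_ge0 ?sqr_ge0.
  move/eqP; rewrite paddr_eq0 ?sqr_ge0// !sqrf_eq0 => /andP[/eqP e1 _].
  by rewrite -/(cnorm w) w0 e1 mul0r mulr0 addr0.
have n2 : cnorm w ^+ 2 = w.1 ^+ 2 + w.2 ^+ 2 by rewrite sqr_sqrtr// addr_ge0 ?sqr_ge0.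
exists (w.1 / cnorm w), (w.2 / cnorm w); split.
  by rewrite !expr_div_n -mulrDl -n2 divff// sqrf_eq0.
transitivity ((w.1 ^+ 2 + w.2 ^+ 2) / cnorm w); first by field.
by rewrite -n2 expr2 mulfK.
Qed.

End SchwarzLemma.

Theorem theorem3 (R : realType) :
  (forall (a : R) (f : R * R -> R * R) (g1 g2 : R -> R),
     -1 < a ->
     (* f* = g1 + i g2 in L^oo(T), parametrized by t in [0, 2pi] *)
     measurable_fun `[0%R, 2 * pi] g1 ->
     measurable_fun `[0%R, 2 * pi] g2 ->
     (exists M : R, {ae @lebesgue_measure R, forall t,
         t \in `[0%R, 2 * pi] -> g1 t ^+ 2 + g2 t ^+ 2 <= M}) ->
     (* f = P_alpha[f*] on the disk *)
     (forall z, cnorm z < 1 -> f z = (Palpha a g1 z, Palpha a g2 z)) ->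
     (* f maps D into D *)
     (forall z, cnorm z < 1 -> cnorm (f z) < 1) ->
     f (0, 0) = (0, 0) ->
     forall z, cnorm z < 1 -> cnorm (f z) <= bound_rhs a (cnorm z)) /\
  (forall r : R, 0 <= r < 1 -> bound_rhs 0 r = 4 / pi * atan r).
Proof.
split; last exact: bound_rhs_atan.
move=> a f g1 g2 a1 mg1 mg2 [M gM] fP fD f0 z z1.
have pi0 := pi_gt0 R.
have mD : measurable (`[0%R, (2 * pi)%R]%classic : set R) by exact: measurable_itv.
(* A bound without square roots: x^2 <= |M| and (|x| - 1)^2 >= 0 give 2|x| <= 1 + |M|. *)
pose C := 1 + `|M|.
have C0 : 0 <= C by rewrite addr_ge0.
have sqC (x y : R) : x ^+ 2 + y ^+ 2 <= M -> `|x| <= C.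
  move=> h; have xM : x ^+ 2 <= `|M| by apply: le_trans (ler_norm M); apply: le_trans h; rewrite lerDl sqr_ge0.
  rewrite -(@real_normK _ x) ?num_real// in xM.
  have := sqr_ge0 (`|x| - 1); rewrite /C; have := normr_ge0 x; nra.
have [g1' [mg1' g1'C P1]] : exists g' : R -> R, [/\ measurable_fun setT g', forall t, `|g' t| <= C &
    forall a r s, 0 <= r -> Palpha a g' (r * cos s, r * sin s) = Palpha a g1 (r * cos s, r * sin s)].
  apply: bounded_representative => //.
  by apply: ae_imply gM => t h Dt; apply: (sqC _ (g2 t)); apply: h.
have [g2' [mg2' g2'C P2]] : exists g' : R -> R, [/\ measurable_fun setT g', forall t, `|g' t| <= C &
    forall a r s, 0 <= r -> Palpha a g' (r * cos s, r * sin s) = Palpha a g2 (r * cos s, r * sin s)].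
  apply: bounded_representative => //.
  by apply: ae_imply gM => t h Dt; apply: (sqC _ (g1 t)); rewrite addrC; apply: h.
have [u1 [u2 [uu uf]]] := unit_direction (f z).
(* The real part of the rotated boundary function. The direction is fixed by f(z), yet the Poisson
   integral of h is bounded by |f| < 1 on the whole disk by Cauchy-Schwarz, while at z it equals
   |f(z)|. *)
pose h t := u1 * g1' t + u2 * g2' t.
have mh : measurable_fun setT h by apply: measurable_funD; apply: measurable_funM.
have hC t : `|h t| <= `|u1| * C + `|u2| * C.
  by rewrite (le_trans (ler_normD _ _))// !normrM lerD// ler_wpM2l.
have Ph r s : 0 <= r < 1 -> Palpha a h (r * cos s, r * sin s) =
    u1 * (f (r * cos s, r * sin s)).1 + u2 * (f (r * cos s, r * sin s)).2.
  move=> /andP[r0 r1]; rewrite fP ?cnorm_polar//= -P1// -P2// !Palpha_polar//.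
  have ik (g : R -> R) : measurable_fun setT g -> (forall t, `|g t| <= C) ->
      lebesgue_measure.-integrable `[0%R, 2 * pi] (EFin \o (fun t => kern a r (cos (t - s)) * g t)).
    move=> mg gC; apply: (@bounded_integrable _ _ _ _ (kern_max a r * C)).
      by apply: measurable_funM => //; exact: measurable_kern_cos.
    by move=> t _; rewrite normrM ler_pM// norm_kern_le ?r0// cos_le1.
  have i1 := ik _ mg1' g1'C; have i2 := ik _ mg2' g2'C.
  have j1 : lebesgue_measure.-integrable `[0%R, 2 * pi] (EFin \o (fun t => u1 * (kern a r (cos (t - s)) * g1' t))).
    by exact: (integrable_scale _ u1 _ mD i1).
  have j2 : lebesgue_measure.-integrable `[0%R, 2 * pi] (EFin \o (fun t => u2 * (kern a r (cos (t - s)) * g2' t))).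
    by exact: (integrable_scale _ u2 _ mD i2).
  rewrite (mulrCA u1) (mulrCA u2) -mulrDr; congr (_ * _).
  rewrite -!RintegralZl// -RintegralD//.
  by apply: eq_Rintegral => t _; rewrite /h; ring.
have [s s2 zE] := polar z.
have r01 : 0 <= cnorm z < 1 by rewrite sqrtr_ge0.
rewrite -uf [in leLHS]zE -Ph//.
apply: (Palpha_schwarz _ _ (`|u1| * C + `|u2| * C)) => //.
  move=> r' s' r'01 s'2; rewrite Ph//; have /andP[r'0 r'1] := r'01.
  apply: le_trans (cauchy_schwarz2 _ _ _ _ uu) _.
  by rewrite -surjective_pairing ltW// fD// cnorm_polar.
have := Ph 0 0; rewrite !mul0r f0/= !mulr0 addr0; apply.
by rewrite lexx ltr01.
Qed.
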